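(* Let $\Gamma$ be a finite quiver with vertex set $\Gamma_0$ and arrow set $\Gamma_1$, let $\tilde{\Gamma}$ be its universal covering quiver, and let $\alpha\in\mathbb{Z}_{\geq 0}^{\Gamma_0}$ be a dimension vector. Then the value at one of the Kac polynomial of $(\Gamma,\alpha)$ is $$a_{\Gamma,\alpha}(1)=\sum_{\beta} a_{\tilde{\Gamma},\beta}(1),$$ where the sum ranges over a complete system of representatives $\beta$ of the equivalence classes of dimension vectors of $\tilde{\Gamma}$ that are compatible with $\alpha$.
   Context: A quiver $\Gamma$ has a finite set of vertices $\Gamma_0$ and a finite set of arrows $\Gamma_1$ (loops and multiple arrows allowed). A representation $M$ of $\Gamma$ over a field $k$ consists of finite-dimensional $k$-vector spaces $(M_i)_{i\in\Gamma_0}$ and linear maps $M_a:M_i\to M_j$ for each arrow $a:i\to j$; its dimension vector is $(\dim_k M_i)_i$. It is absolutely indecomposable if $M\otimes_k K$ is indecomposable for every finite extension $K|k$. Kac polynomial: the number of isomorphism classes of absolutely indecomposable representations of $\Gamma$ of dimension vector $\alpha$ over $\mathbb{F}_q$ is a polynomial in $q$ with integer coefficients (Kac), denoted $a_{\Gamma,\alpha}(q)$. For an infinite quiver and a finitely supported dimension vector $\beta$, $a_{\tilde\Gamma,\beta}(q)$ is defined in the same way (equivalently, it is the Kac polynomial of the finite full subquiver on the support of $\beta$). Universal covering quiver: let $W_\Gamma$ be the free group generated by $\Gamma_1$. Then $\tilde{\Gamma}_0=\Gamma_0\times W_\Gamma$, $\tilde{\Gamma}_1=\Gamma_1\times W_\Gamma$,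 where for an arrow $a:i\to j$ of $\Gamma$ and $w\in W_\Gamma$ the arrow $(a,w)$ goes from $(i,w)$ to $(j,wa)$. A dimension vector of $\tilde{\Gamma}$ is a finitely supported $\beta=(\beta_{i,w})\in\mathbb{Z}_{\ge 0}^{\tilde{\Gamma}_0}$. It is compatible with $\alpha$ if $\sum_{w\in W_\Gamma}\beta_{i,w}=\alpha_i$ for all $i\in\Gamma_0$. The group $W_\Gamma$ acts on $\tilde\Gamma$ by left multiplication on the second component, $u.(i,w)=(i,uw)$ and $u.(a,w)=(a,uw)$, hence on dimension vectors of $\tilde\Gamma$; two dimension vectors are equivalent if they lie in the same $W_\Gamma$-orbit. Up to equivalence only finitely many dimension vectors with connected support are compatible with $\alpha$, and $a_{\tilde\Gamma,\beta}=0$ if the support of $\beta$ is not connected, so the sum has only finitely many non-zero terms. *)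

(* Defs.v *)
From HB Require Import structures.
From mathcomp Require Import all_boot all_order all_algebra fieldext.
From mathcomp Require Import finmap.
From mathcomp Require Import boolp classical_sets functions cardinality fsbigop.

Set Implicit Arguments.
Unset Strict Implicit.
Unset Printing Implicit Defensive.

Import GRing.Theory Num.Theory.

Local Open Scope classical_set_scope.
Local Open Scope card_scope.
Local Open Scope ring_scope.

(** The free group on [T]: reduced words in the letters [(x, false)] (read [x])
    and [(x, true)] (read [x^-1]). *)

Section FreeGroup.
Variable T : choiceType.
Implicit Types (l : T * bool) (u v w : seq (T * bool)).

Definition linv l : T * bool := (l.1, ~~ l.2).

Definition reduced w : bool := sorted (fun l l' => l' != linv l) w.

Record freegroup := FreeGroup { fgword :> seq (T * bool); _ : reduced fgword }.

HB.instance Definition _ := [isSub for fgword].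
HB.instance Definition _ := [Choice of freegroup by <:].

Definition wcons l w : seq (T * bool) :=
  if w is l' :: w' then if l' == linv l then w' else l :: w else [:: l].

Definition wmul u v : seq (T * bool) := foldr wcons v u.

Definition winv w : seq (T * bool) := rev (map linv w).

Lemma linvK : involutive linv.
Proof. by case=> x b; rewrite /linv /= negbK. Qed.

Lemma reduced_wcons l w : reduced w -> reduced (wcons l w).
Proof.
case: w => [|l' w] //= hw; case: ifP => [_|/negbT h]; last by rewrite /= h.
exact: path_sorted hw.
Qed.

Lemma reduced_wmul u v : reduced v -> reduced (wmul u v).
Proof. by move=> hv; elim: u => //= l u; exact: reduced_wcons. Qed.

Lemma reduced_winv w : reduced w -> reduced (winv w).
Proof.
rewrite /reduced /winv rev_sorted sorted_map; apply: sub_sorted => l l'.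
by rewrite /= linvK eq_sym.
Qed.

Lemma wconsK l w : reduced w -> wcons l (wcons (linv l) w) = w.
Proof.
case: w => [|l' w] /=; first by rewrite eqxx.
rewrite linvK; case: eqP => [->|_ _] /=; last by rewrite eqxx.
by case: w => [|l2 w] //= /andP[/negPf->].
Qed.

Lemma wmul1 u : reduced u -> wmul u [::] = u.
Proof.
elim: u => //= l u IH h; rewrite (IH (path_sorted h)).
by case: u h {IH} => //= l' u /andP[/negPf->].
Qed.

Lemma wmul_wcons l u v : reduced v -> wmul (wcons l u) v = wcons l (wmul u v).
Proof.
case: u => [|l' u] //= hv; case: eqP => [->|//].
by rewrite wconsK ?reduced_wmul.
Qed.

Lemma wmulA u v w : reduced w -> wmul u (wmul v w) = wmul (wmul u v) w.
Proof. by move=> hw; elim: u => //= l u IH; rewrite IH wmul_wcons. Qed.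

Lemma wmulV u : reduced u -> wmul u (winv u) = [::].
Proof.
suff H v : reduced v -> wmul u (wmul (winv u) v) = v.
  by move=> hu; rewrite -[winv u]wmul1 ?H ?reduced_winv.
elim: u v => [|l u IH] v hv //; rewrite /winv /= rev_cons -cats1 /wmul foldr_cat.
by rewrite -/(winv u) -!/(wmul _ _) IH ?wconsK //; exact: reduced_wcons.
Qed.

Lemma winvK u : winv (winv u) = u.
Proof. by rewrite /winv map_rev revK mapK //; exact: linvK. Qed.

Definition fgone : freegroup := @FreeGroup [::] isT.
Definition fgmul (u v : freegroup) : freegroup :=
  FreeGroup (reduced_wmul u (valP v)).
Definition fginv (u : freegroup) : freegroup := FreeGroup (reduced_winv (valP u)).

Lemma fgmulA : associative fgmul.
Proof. by move=> u v w; apply: val_inj; apply/wmulA/valP. Qed.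
Lemma fgmul1g : left_id fgone fgmul.
Proof. by move=> u; apply: val_inj. Qed.
Lemma fgmulg1 : right_id fgone fgmul.
Proof. by move=> u; apply/val_inj/wmul1/valP. Qed.
Lemma fgmulgV : right_inverse fgone fginv fgmul.
Proof. by move=> u; apply/val_inj/wmulV/valP. Qed.
Lemma fgmulVg : left_inverse fgone fginv fgmul.
Proof.
move=> u; apply: val_inj; rewrite /= -{2}[val u]winvK.
exact/wmulV/reduced_winv/valP.
Qed.

HB.instance Definition _ :=
  isGroup.Build freegroup fgmulA fgmul1g fgmulg1 fgmulVg fgmulgV.

Definition fggen (x : T) : freegroup := @FreeGroup [:: (x, false)] isT.

End FreeGroup.

(** Possibly infinite: finite quivers are those on [finType]s. *)

Record quiver (V A : Type) := Quiver { src : A -> V; tgt : A -> V }.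

(** The space M_i of a representation is the space k^(d i) of row vectors, and
    the matrix of an arrow acts on it by right multiplication. *)

Section Representations.
Variables (V A : Type) (Q : quiver V A).
Implicit Types (k : fieldType) (d : V -> nat).

Definition rep (k : fieldType) (d : V -> nat) :=
  forall a : A, 'M[k]_(d (src Q a), d (tgt Q a)).

Definition is_rep_hom k d d' (M : rep k d) (N : rep k d')
    (f : forall i, 'M[k]_(d i, d' i)) :=
  forall a, M a *m f (tgt Q a) = f (src Q a) *m N a.

Definition rep_iso k d d' (M : rep k d) (N : rep k d') :=
  exists f g, [/\ is_rep_hom M N f, is_rep_hom N M g,
    forall i, f i *m g i = 1%:M & forall i, g i *m f i = 1%:M].

Definition rep_dsum k d d' (M : rep k d) (N : rep k d') :
    rep k (fun i => (d i + d' i)%N) :=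
  fun a => block_mx (M a) 0 0 (N a).

Definition indecomposable k d (M : rep k d) :=
  ~ (forall i, d i = 0%N) /\
  forall d1 d2 (M1 : rep k d1) (M2 : rep k d2), rep_iso M (rep_dsum M1 M2) ->
    (forall i, d1 i = 0%N) \/ (forall i, d2 i = 0%N).

Definition extend_scalars (k : fieldType) (K : fieldExtType k) d
    (M : rep k d) : rep K d :=
  fun a => map_mx (in_alg K) (M a).

Definition absolutely_indecomposable (k : fieldType) d (M : rep k d) :=
  forall K : fieldExtType k, indecomposable (extend_scalars K M).

Definition isoclass k d (M : rep k d) : set (rep k d) :=
  [set N | rep_iso M N].

Definition absindec_classes (k : fieldType) d : set (set (rep k d)) :=
  [set isoclass M | M in [set M : rep k d | absolutely_indecomposable M]].
Arguments absindec_classes : clear implicits.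

(** [P] is the Kac polynomial of [(Q, d)]: it counts the isomorphism classes of
    absolutely indecomposable representations over every finite field. There are
    infinitely many finite field orders, so there is at most one such [P]. *)
Definition is_kac_polynomial (d : V -> nat) (P : {poly int}) :=
  forall F : finFieldType, exists2 n : nat,
    absindec_classes F d #= `I_n & P.[#|F|%:R] = n%:R.

End Representations.

Lemma is_kac_polynomial_unique V A (Q : quiver V A) d P P' :
  is_kac_polynomial Q d P -> is_kac_polynomial Q d P' -> P = P'.
Proof.
move=> hP hP'; apply/eqP; rewrite -subr_eq0; apply/negP => /negP nz.
have rt p : prime p -> root (P - P') p%:R.
  move=> pp; have [n hn en] := hP 'F_p; have [n' hn' en'] := hP' 'F_p.
  rewrite -(card_Fp pp) rootE hornerD hornerN en en' subr_eq0 eqr_nat.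
  by apply/eqP/card_eq_II; rewrite -(card_eql hn).
have [s [sz us ps]] : exists s : seq nat,
    [/\ size s = size (P - P'), uniq s & all prime s].
  elim: (size _) => [|m [s [sz us ps]]]; first by exists [::].
  have [p ltp pp] := prime_above (\max_(x <- s) x).
  exists (p :: s); split; rewrite /= ?sz ?pp // us andbT.
  by apply/negP => /(@leq_bigmax_seq _ _ xpredT id)/(_ isT); rewrite leqNgt ltp.
have := @max_poly_roots _ (P - P') [seq p%:R | p <- s] nz.
rewrite all_map size_map sz ltnn map_inj_uniq ?us; last first.
  by move=> m n /eqP; rewrite eqr_nat => /eqP.
by move=> /(_ _ isT) H; apply/notF/H/allP => p /(allP ps)/rt.
Qed.

Definition dimvec (V : choiceType) := {fsfun V -> nat with 0%N}.

HB.instance Definition _ (V : choiceType) := [Choice of dimvec V by <:].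

Section Covering.
Variables (V A : finType) (Q : quiver V A).
Local Notation W := (freegroup A).
Local Open Scope group_scope.

Definition universal_cover : quiver (V * W)%type (A * W)%type :=
  {| src := fun aw => (src Q aw.1, aw.2);
     tgt := fun aw => (tgt Q aw.1, aw.2 * fggen aw.1) |}.

Definition cover_act (u : W) (x : V * W) : V * W := (x.1, u * x.2).

Definition compatible (alpha : V -> nat) (beta : dimvec (V * W)%type) :=
  forall i, (\sum_(x <- finsupp beta | x.1 == i) beta x)%N = alpha i.

Definition equivalent (beta beta' : dimvec (V * W)%type) :=
  exists u : W, forall x, beta' (cover_act u x) = beta x.

Definition complete_representatives (alpha : V -> nat)
    (S : set (dimvec (V * W)%type)) :=
  S `<=` [set beta | compatible alpha beta] /\
  forall beta, compatible alpha beta ->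
    exists! gamma, S gamma /\ equivalent beta gamma.

End Covering.

(* Main.v *)
Require Import Defs.
From mathcomp Require Import all_boot all_order all_algebra.
From mathcomp Require Import all_fingroup all_solvable all_field.
From mathcomp Require Import finmap.
From mathcomp Require Import boolp classical_sets functions cardinality fsbigop.

Set Implicit Arguments.
Unset Strict Implicit.
Unset Printing Implicit Defensive.

Import GRing.Theory.
Local Open Scope ring_scope.

(** Counting happens over a finite field [F] and modulo a prime [l] that is large
    compared with the dimension vector [alpha] and divides [#|F| - 1]. Since
    [P.[q] = P.[1]] modulo [q - 1], the theorem follows once the number of
    classes of absolutely indecomposable representations of dimension [alpha] is
    congruent modulo [l] to the number of those coming from the universal
    covering, for infinitely many [l].

    A representation of the covering attached to a group [G] and a map
    [g : A -> G] is a representation of the quiver whose basis vectors carry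
    degrees in [G], the arrow [a] multiplying degrees by [g a] on the right
    ([graded]). The universal covering is the case of the free group; the trivial
    group imposes nothing. Between the two lie finite [l]-groups, which are
    iterated central extensions [G -> Gb] by a group of order [l]. For one such
    extension, a character of the kernel with values in the [l]-th roots of unity
    of [F] twists [Gb]-graded representations, and this permutes their classes
    with order [l] ([gradable_central_extension]). The fixed classes are exactly
    the [G]-gradable ones ([twist_fixed_gradable]): an isomorphism of [M] with its
    twist can be normalized to have order [l], and then its eigenvalues refine the
    grading. Hence the number of [G]-gradable classes modulo [l] does not depend
    on the [l]-group [G] ([lgroup_gradable_classes]).

    Free groups are residually [l]-groups ([free_group_residually_lgroup]), and
    the total dimension bounds the length of closed walks in the coefficient graph
    of a representation. So a grading by an [l]-group in which all short reduced
    words are nontrivial is as good as one by the free group ([gradable_lift]).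

    Two facts about gradings hold the argument together. A grading of an
    indecomposable representation is unique up to translation ([graded_iso]),
    which makes twists well defined on classes and pushing down injective. And if
    a graded representation has no homogeneous idempotents and its degrees admit
    no nontrivial translation, then it has no idempotents at all
    ([graded_trivial_idempotents]), so twisting and pushing down preserve absolute
    indecomposability. Both are applied to the free group, which is torsion free, and to
    [l]-groups, since all dimensions are smaller than [l]. *)

(** * Homomorphisms and direct sums *)

Lemma exists_dim_gt0 (V : Type) (d : V -> nat) :
  ~ (forall i, d i = 0%N) -> exists i, (0 < d i)%N.
Proof.
move=> nz; apply: contrapT => z; apply: nz => i; apply/eqP; rewrite -leqn0 leqNgt.
by apply/negP => di; apply: z; exists i.
Qed.

Lemma sum_neq0 (R : nmodType) (I : Type) (s : seq I) (E : I -> R) :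
  \sum_(j <- s) E j != 0 -> exists j, E j != 0.
Proof.
move=> nz; apply: contrapT => all0; case/eqP: nz; apply: big1 => j _.
by apply/eqP/negPn/negP => nz; apply: all0; exists j.
Qed.

Section Hom.
Variables (V A : Type) (Q : quiver V A) (K : fieldType).
Implicit Types (d : V -> nat).

Lemma rep_hom_id d (M : rep Q K d) : is_rep_hom M M (fun=> 1%:M).
Proof. by move=> a; rewrite mulmx1 mul1mx. Qed.

Lemma rep_hom_comp d1 d2 d3 (M1 : rep Q K d1) (M2 : rep Q K d2)
    (M3 : rep Q K d3) f g :
  is_rep_hom M1 M2 f -> is_rep_hom M2 M3 g ->
  is_rep_hom M1 M3 (fun i => f i *m g i).
Proof. by move=> hf hg a; rewrite mulmxA hf -mulmxA hg mulmxA. Qed.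

Lemma rep_hom_add d1 d2 (M1 : rep Q K d1) (M2 : rep Q K d2) f g :
  is_rep_hom M1 M2 f -> is_rep_hom M1 M2 g ->
  is_rep_hom M1 M2 (fun i => f i + g i).
Proof. by move=> hf hg a; rewrite mulmxDr mulmxDl hf hg. Qed.

Lemma rep_hom_scale d1 d2 (M1 : rep Q K d1) (M2 : rep Q K d2) c f :
  is_rep_hom M1 M2 f -> is_rep_hom M1 M2 (fun i => c *: f i).
Proof. by move=> hf a; rewrite -scalemxAr -scalemxAl hf. Qed.

Lemma rep_hom_sum d1 d2 (M1 : rep Q K d1) (M2 : rep Q K d2) (I : Type)
    (s : seq I) f :
  (forall j, is_rep_hom M1 M2 (f j)) ->
  is_rep_hom M1 M2 (fun i => \sum_(j <- s) f j i).
Proof.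
by move=> hf a; rewrite mulmx_sumr mulmx_suml; apply: eq_bigr => j _; apply: hf.
Qed.

Lemma rep_hom_exp d (M : rep Q K d) f n :
  is_rep_hom M M f -> is_rep_hom M M (fun i => f i ^+ n).
Proof.
move=> hf; elim: n => [|n IH] a; first by rewrite !expr0 mulmx1 mul1mx.
by rewrite !exprS -!mulmxE mulmxA hf -mulmxA IH mulmxA.
Qed.

Lemma rep_iso_refl d (M : rep Q K d) : rep_iso M M.
Proof.
by exists (fun=> 1%:M), (fun=> 1%:M); split=> [||i|i]; rewrite ?mulmx1 //;
  apply: rep_hom_id.
Qed.

Lemma rep_iso_sym d1 d2 (M1 : rep Q K d1) (M2 : rep Q K d2) :
  rep_iso M1 M2 -> rep_iso M2 M1.
Proof. by case=> f [g [h1 h2 h3 h4]]; exists g, f. Qed.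

Lemma rep_iso_trans d1 d2 d3 (M1 : rep Q K d1) (M2 : rep Q K d2)
    (M3 : rep Q K d3) :
  rep_iso M1 M2 -> rep_iso M2 M3 -> rep_iso M1 M3.
Proof.
case=> f [g [h1 h2 h3 h4]] [f' [g' [k1 k2 k3 k4]]].
exists (fun i => f i *m f' i), (fun i => g' i *m g i); split=> [||i|i].
- exact: rep_hom_comp h1 k1.
- exact: rep_hom_comp k2 h2.
- by rewrite mulmxA -(mulmxA (f i)) k3 mulmx1.
- by rewrite mulmxA -(mulmxA (g' i)) h4 mulmx1.
Qed.

Lemma rep_hom_inv d1 d2 (M1 : rep Q K d1) (M2 : rep Q K d2) f g :
  is_rep_hom M1 M2 f -> (forall i, f i *m g i = 1%:M) ->
  (forall i, g i *m f i = 1%:M) -> is_rep_hom M2 M1 g.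
Proof.
move=> hf fg gf a.
rewrite -[LHS]mul1mx -gf -mulmxA [f _ *m (_ *m _)]mulmxA -hf.
by rewrite -!mulmxA fg mulmx1.
Qed.

Lemma rep_iso_unit d (M1 M2 : rep Q K d) f :
  is_rep_hom M1 M2 f -> (forall i, f i \in unitmx) -> rep_iso M1 M2.
Proof.
move=> hf uf; exists f, (fun i => invmx (f i)); split=> // [|i|i].
- by apply: rep_hom_inv hf _ _ => i; rewrite ?mulmxV ?mulVmx.
- by rewrite mulmxV.
- by rewrite mulVmx.
Qed.

(** Direct sum decompositions of [M] are the idempotents of its endomorphism
    algebra; quantifying over the latter keeps every dimension vector fixed. *)
Definition trivial_idempotents d (M : rep Q K d)
    (P : (forall i, 'M[K]_(d i)) -> Prop) :=
  forall e, P e -> is_rep_hom M M e -> (forall i, e i *m e i = e i) ->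
    (forall i, e i = 0) \/ (forall i, e i = 1%:M).

(** A rank factorization of an idempotent is a section followed by a retraction. *)
Lemma idempotent_splitting n (e : 'M[K]_n) : e *m e = e ->
  row_base e *m col_base e = 1%:M.
Proof.
move=> ee; apply: (row_free_inj (row_base_free e)).
apply: (row_full_inj (col_base_full e)).
by rewrite /= mul1mx -mulmxA mulmx_base mulmxA mulmx_base ee.
Qed.

Lemma scalar_mx1_eq0 n : (1%:M : 'M[K]_n) = 0 -> n = 0%N.
Proof.
case: n => // n /matrixP/(_ ord0 ord0); rewrite !mxE eqxx => /eqP.
by rewrite oner_eq0.
Qed.

(** An idempotent [e] splits [M] into the images of [e] and [1 - e]; rank
    factorizations of these two matrices at each vertex give the bases. *)
Lemma indecomposableP d (M : rep Q K d) :
  indecomposable M <->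
  ~ (forall i, d i = 0%N) /\ trivial_idempotents M (fun=> True).
Proof.
split=> -[nz H]; split=> //; last first.
  move=> d1 d2 M1 M2 [f [g [hf hg fg gf]]].
  pose b i : 'M[K]_(d1 i + d2 i) := block_mx 1%:M 0 0 0.
  have hb : is_rep_hom (rep_dsum M1 M2) (rep_dsum M1 M2) b.
    by move=> a; rewrite /b /rep_dsum !mulmx_block;
       rewrite !(mulmx0, mul0mx, mulmx1, mul1mx, addr0).
  have bE i : b i = g i *m (f i *m b i *m g i) *m f i.
    by rewrite !mulmxA gf mul1mx -mulmxA gf mulmx1.
  have bb i : b i *m b i = b i.
    by rewrite /b mulmx_block !(mulmx0, mul0mx, mulmx1, addr0).
  have [|||h0|h1] := H (fun i => f i *m b i *m g i).
  - by [].
  - exact: rep_hom_comp (rep_hom_comp hf hb) hg.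
  - move=> i; rewrite !mulmxA -(mulmxA _ (g i)) gf mulmx1.
    by rewrite -(mulmxA (f i)) bb.
  - left=> i; have := bE i; rewrite h0 mulmx0 mul0mx.
    rewrite /b -[RHS](block_mx0 _ (d1 i) _ (d1 i)).
    by case/eq_block_mx => /scalar_mx1_eq0.
  - right=> i; have := bE i; rewrite h1 mulmx1 gf /b.
    rewrite (scalar_mx_block _ _ 1).
    by case/eq_block_mx => _ _ _ /esym /scalar_mx1_eq0.
move=> e _ he ee.
pose e' i := 1%:M - e i.
have ee' i : e' i *m e' i = e' i.
  rewrite /e' mulmxBl mul1mx mulmxBr mulmx1 ee subrr subr0 //.
have e0 i : e i *m e' i = 0 by rewrite mulmxBr mulmx1 ee subrr.
have e0' i : e' i *m e i = 0 by rewrite mulmxBl mul1mx ee subrr.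
have he' : is_rep_hom M M e'.
  by move=> a; rewrite mulmxBl mulmxBr mulmx1 mul1mx he.
pose U i := row_base (e i); pose C i := col_base (e i).
pose U' i := row_base (e' i); pose C' i := col_base (e' i).
have CU i : C i *m U i = e i by apply: mulmx_base.
have CU' i : C' i *m U' i = e' i by apply: mulmx_base.
have UC i : U i *m C i = 1%:M by apply: idempotent_splitting.
have UC' i : U' i *m C' i = 1%:M by apply: idempotent_splitting.
have eC i : e i *m C i = C i.
  by have := congr1 (mulmx^~ (C i)) (CU i); rewrite /= -mulmxA UC mulmx1.
have eC' i : e' i *m C' i = C' i.
  by have := congr1 (mulmx^~ (C' i)) (CU' i); rewrite /= -mulmxA UC' mulmx1.
have Ue i : U i *m e i = U i.
  by have := congr1 (mulmx (U i)) (CU i); rewrite /= mulmxA UC mul1mx.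
have Ue' i : U' i *m e' i = U' i.
  by have := congr1 (mulmx (U' i)) (CU' i); rewrite /= mulmxA UC' mul1mx.
have UC0 i : U i *m C' i = 0 by rewrite -Ue -eC' mulmxA -(mulmxA (U i)) e0 mulmx0 mul0mx.
have UC0' i : U' i *m C i = 0 by rewrite -Ue' -eC mulmxA -(mulmxA (U' i)) e0' mulmx0 mul0mx.
clearbody U C U' C'.
pose M1 : rep Q K (fun i => \rank (e i)) :=
  fun a => U (src Q a) *m M a *m C (tgt Q a).
pose M2 : rep Q K (fun i => \rank (e' i)) :=
  fun a => U' (src Q a) *m M a *m C' (tgt Q a).
have fg i : row_mx (C i) (C' i) *m col_mx (U i) (U' i) = 1%:M.
  by rewrite mul_row_col CU CU' /e' addrC subrK.
have gf i : col_mx (U i) (U' i) *m row_mx (C i) (C' i) = 1%:M.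
  by rewrite mul_col_row UC UC' UC0 UC0' -scalar_mx_block.
have hf : is_rep_hom M (rep_dsum M1 M2) (fun i => row_mx (C i) (C' i)).
  move=> a; rewrite mul_mx_row /rep_dsum mul_row_block !mulmx0 addr0 add0r.
  by rewrite /M1 /M2 !mulmxA CU CU' -he -he' -!mulmxA eC eC'.
have [h|h] : (forall i, \rank (e i) = 0%N) \/ (forall i, \rank (e' i) = 0%N).
- apply: (H _ _ M1 M2).
  exists (fun i => row_mx (C i) (C' i)), (fun i => col_mx (U i) (U' i)).
  by split=> //; apply: rep_hom_inv hf fg gf.
- by left=> i; apply/eqP; rewrite -mxrank_eq0 h.
- right=> i; have /eqP := h i; rewrite mxrank_eq0 => /eqP /eqP.
  by rewrite subr_eq0 => /eqP.
Qed.

End Hom.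

(** * Endomorphism algebras without idempotents are local *)

(** The exponent is uniform in the matrix, so that applying it at every vertex to
    an endomorphism of a representation gives an endomorphism. *)
Definition idempotent_powers (K : fieldType) := forall n, exists2 N, (0 < N)%N &
  forall m (A : 'M[K]_m), (m <= n)%N -> A ^+ N * A ^+ N = A ^+ N.

(** In a monoid with at most [C] elements the powers of an element become periodic
    before exponent [C], with a period dividing [C`!]. *)
Lemma finField_idempotent_powers (K : finFieldType) : idempotent_powers K.
Proof.
move=> n; pose C := (#|K| ^ (n * n))%N; exists C`!; first exact: fact_gt0.
move=> m A mn.
have cM : (#|[the finType of 'M[K]_m]| <= C)%N.
  by rewrite card_mx leq_exp2l ?finRing_gt1 // leq_mul.
have : ~~ injectiveb (fun j : 'I_C.+1 => A ^+ j).
  by apply/negP => /injectiveP/leq_card; rewrite card_ord leqNgt ltnS cM.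
case/injectivePn => i [j ij Aij].
wlog lt_ij : i j ij Aij / (i < j)%N.
  case: (ltngtP i j) => [lt_ij|lt_ji|/val_inj eij] W.
  - exact: W Aij lt_ij.
  - by apply: W (esym Aij) lt_ji; rewrite eq_sym.
  - by rewrite eij eqxx in ij.
have per k : A ^+ (i + k * (j - i)) = A ^+ i.
  elim: k => [|k IH]; first by rewrite mul0n addn0.
  by rewrite mulSn addnA subnKC ?(ltnW lt_ij) // exprD -Aij -exprD.
have [k Ek] : exists k, C`! = (k * (j - i))%N.
  apply/dvdnP/dvdn_fact; rewrite subn_gt0 lt_ij /=.
  by rewrite (leq_trans (leq_subr _ _)) // -ltnS.
have le_i : (i <= C`!)%N.
  have : (C <= C`!)%N.
    by case: (C) => // c; rewrite factS leq_pmulr // fact_gt0.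
  by apply: leq_trans; rewrite -ltnS.
have E : (C`! + C`! = (C`! - i) + (i + k * (j - i)))%N.
  by rewrite -Ek addnA subnK.
by rewrite -exprD E exprD per -exprD subnK.
Qed.

(** A finite extension of a finite field is again a finite field. *)
Lemma finext_idempotent_powers (F : finFieldType) (K : fieldExtType F) :
  idempotent_powers K.
Proof. exact: (@finField_idempotent_powers (finvect_type K)). Qed.

Lemma det_expmx (K : fieldType) n (B : 'M[K]_n) m : \det (B ^+ m) = \det B ^+ m.
Proof.
elim: m => [|m IH]; first exact: det1.
by rewrite !exprS -IH -mulmxE det_mulmx.
Qed.

Lemma det_mx0 (K : fieldType) n : (0 < n)%N -> \det (0 : 'M[K]_n) = 0.
Proof. by case: n => // n _; apply: det0. Qed.

Section LocalAlgebra.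
Variables (V A : Type) (Q : quiver V A) (K : fieldType) (d : V -> nat) (n : nat).
Hypotheses (dn : forall i, (d i <= n)%N) (powK : idempotent_powers K).
Local Notation family := (forall i, 'M[K]_(d i)).

Definition subalgebra (P : family -> Prop) := [/\ P (fun=> 1%:M),
  forall f g, P f -> P g -> P (fun i => f i + g i),
  forall c f, P f -> P (fun i => c *: f i) &
  forall f g, P f -> P g -> P (fun i => f i *m g i)].

Variables (M : rep Q K d) (P : family -> Prop).
Hypotheses (algP : subalgebra P) (triv : trivial_idempotents M P).
Variables (i0 : V) (d0 : (0 < d i0)%N).

Lemma subalgebra_exp f m : P f -> P (fun i => f i ^+ m).
Proof.
case: algP => P1 _ _ PM Pf; elim: m => [|m IH]; first exact: P1.
suff -> : (fun i => f i ^+ m.+1) = (fun i => f i *m f i ^+ m) by apply: PM.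
by apply: functional_extensionality_dep => i; rewrite exprS.
Qed.

(** Some power of [f] is idempotent, hence [0] or [1] at all vertices; the
    determinant at a single vertex of nonzero dimension tells which. *)
Lemma nilpotent_or_invertible f : P f -> is_rep_hom M M f ->
  exists2 N, (0 < N)%N &
    if \det (f i0) == 0 then forall i, f i ^+ N = 0 else forall i, f i ^+ N = 1.
Proof.
move=> Pf hf; have [N N0 HN] := powK n; exists N => //.
have [z|u] := triv (subalgebra_exp N Pf) (rep_hom_exp N hf) (fun i => HN _ _ (dn i)).
  have := congr1 determinant (z i0); rewrite det_expmx det_mx0 // => /eqP.
  by rewrite expf_eq0 => /andP[_ ->].
have := congr1 determinant (u i0); rewrite det_expmx det1.
by case: eqP => // ->; rewrite expr0n gtn_eqF // => /esym/eqP; rewrite oner_eq0.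
Qed.

(** Were [f + g] a unit with inverse [u], then [f u = 1 - g u], where [g u] is
    nilpotent, would be one as well. *)
Lemma det_add_eq0 f g : P f -> P g -> is_rep_hom M M f -> is_rep_hom M M g ->
  \det (f i0) = 0 -> \det (g i0) = 0 -> \det (f i0 + g i0) = 0.
Proof.
case: algP => P1 PD PZ PM Pf Pg hf hg f0 g0; apply/eqP/negPn/negP => fg.
have Pfg := PD _ _ Pf Pg; have hfg := rep_hom_add hf hg.
have [[//|N] _] := nilpotent_or_invertible Pfg hfg; rewrite (negPf fg) => EN.
pose u i : 'M[K]_(d i) := (f i + g i) ^+ N.
have Pu : P u := subalgebra_exp N Pfg; have hu := rep_hom_exp N hfg.
have Pgu : P (fun i => g i *m u i) by apply: PM.
have hgu : is_rep_hom M M (fun i => g i *m u i) by apply: rep_hom_comp hg hu.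
have [m m0] := nilpotent_or_invertible Pgu hgu.
rewrite det_mulmx g0 mul0r eqxx => /(_ i0) nil.
have fu : f i0 *m u i0 = 1 - g i0 *m u i0.
  by rewrite -(EN i0) exprS mulrDl -/(u i0) addrK.
have /(congr1 determinant) : (1 - (g i0 *m u i0)) * (\sum_(k < m) (g i0 *m u i0) ^+ k) = 1.
  by rewrite -opprB mulNr -subrX1 nil sub0r opprK.
rewrite -mulmxE -fu !det_mulmx f0 !mul0r det1 => /esym/eqP; by rewrite oner_eq0.
Qed.

Lemma det_sum_eq0 (I : eqType) (s : seq I) (f : I -> family) :
  (forall j, P (f j)) -> (forall j, is_rep_hom M M (f j)) ->
  (forall j, j \in s -> \det (f j i0) = 0) -> \det (\sum_(j <- s) f j i0) = 0.
Proof.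
case: algP => P1 PD PZ PM Pf hf.
suff S t : P (fun i => \sum_(j <- t) f j i).
  elim: s => [|j s IH] f0; first by rewrite big_nil det_mx0.
  rewrite big_cons; apply: (@det_add_eq0 (f j) (fun i => \sum_(j <- s) f j i)) => //.
  - exact: rep_hom_sum.
  - by apply: f0; rewrite mem_head.
  - by apply: IH => k ks; apply: f0; rewrite in_cons ks orbT.
elim: t => [|j t IH].
  suff -> : (fun i => \sum_(j <- [::]) f j i) = (fun i => 0 *: 1%:M) by apply: PZ.
  by apply: functional_extensionality_dep => i; rewrite big_nil scale0r.
suff -> : (fun i => \sum_(k <- j :: t) f k i) =
  (fun i => f j i + \sum_(k <- t) f k i) by apply: PD.
by apply: functional_extensionality_dep => i; rewrite big_cons.
Qed.

End LocalAlgebra.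

Lemma subalgebraT V K (d : V -> nat) : @subalgebra V K d (fun=> True).
Proof. by []. Qed.

(** * Group gradings of representations *)

Section Gradings.
Variables (V A : Type) (Q : quiver V A) (K : fieldType) (G : groupType).
Variable (g : A -> G).
Implicit Types (d : V -> nat).
Local Notation degrees d := (forall i, 'I_(d i) -> G).

(** This is a representation of the covering of [Q] with vertices [V * G], seen on
    the total spaces: keeping those fixed avoids dimension vectors indexed by [G]. *)
Definition graded d (M : rep Q K d) (D : degrees d) :=
  forall a r c, M a r c != 0 -> D _ c = (D _ r * g a)%g.

Definition gradable d (M : rep Q K d) :=
  exists (N : rep Q K d) (D : degrees d), rep_iso M N /\ graded N D.

(** Left translation of degrees, since arrows act on the right. *)
Definition shifts d d' h (D : degrees d) (D' : degrees d')
    (f : forall i, 'M[K]_(d i, d' i)) :=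
  forall i r c, f i r c != 0 -> D' i c = (h * D i r)%g.

Definition component d d' h (D : degrees d) (D' : degrees d')
    (f : forall i, 'M[K]_(d i, d' i)) i :=
  \matrix_(r, c) (f i r c *+ (D' i c == h * D i r)%g).

Lemma component_shifts d d' h D D' f : shifts h D D' (@component d d' h D D' f).
Proof. by move=> i r c; rewrite mxE; case: (D' i c =P _) => // _; rewrite eqxx. Qed.

Lemma component_hom d d' (M : rep Q K d) (M' : rep Q K d') h D D' f :
  graded M D -> graded M' D' -> is_rep_hom M M' f ->
  is_rep_hom M M' (component h D D' f).
Proof.
move=> hM hM' hf a; apply/matrixP => r c; have /matrixP/(_ r c) := hf a.
rewrite !mxE => E.
transitivity ((\sum_j M a r j * f _ j c) *+ (D' _ c == h * (D _ r * g a))%g).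
  rewrite -sumrMnl; apply: eq_bigr => j _; rewrite mxE.
  have [->|/hM ->] := eqVneq (M a r j) 0; first by rewrite !mul0r mul0rn.
  by rewrite mulrnAr.
rewrite E -sumrMnl; apply: eq_bigr => j _; rewrite mxE.
have [->|/hM' ->] := eqVneq (M' a j c) 0; first by rewrite !mulr0 mul0rn.
by rewrite mulgA (inj_eq (mulIg _)) mulrnAl.
Qed.

Lemma component_id d d' h (D : degrees d) (D' : degrees d') f i :
  shifts h D D' f -> component h D D' f i = f i.
Proof.
move=> hf; apply/matrixP => r c; rewrite mxE.
by have [->|/hf ->] := eqVneq (f i r c) 0; rewrite ?mul0rn // eqxx.
Qed.

Lemma shifts1 d (D : degrees d) : shifts 1%g D D (fun i => 1%:M).
Proof.
by move=> i r c; rewrite mxE mul1g; case: (eqVneq r c) => [->|_] //; rewrite eqxx.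
Qed.

Lemma component1 d (D : degrees d) i : component 1%g D D (fun i => 1%:M) i = 1%:M.
Proof. exact/component_id/shifts1. Qed.

Lemma mul_component d d' d'' h k (D : degrees d) (D' : degrees d')
    (D'' : degrees d'') f f' i :
  shifts h D D' f ->
  f i *m component k D' D'' f' i =
  component (k * h)%g D D'' (fun i => f i *m f' i) i.
Proof.
move=> hf; apply/matrixP => r c; rewrite !mxE -sumrMnl; apply: eq_bigr => j _.
rewrite mxE; have [->|/hf ->] := eqVneq (f i r j) 0; first by rewrite !mul0r mul0rn.
by rewrite mulgA mulrnAr.
Qed.

Lemma shifts_comp d d' d'' h k (D : degrees d) (D' : degrees d')
    (D'' : degrees d'') f f' :
  shifts h D D' f -> shifts k D' D'' f' ->
  shifts (k * h)%g D D'' (fun i => f i *m f' i).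
Proof.
move=> hf hf' i r c; rewrite mxE => nz.
have [j] := sum_neq0 nz; rewrite mulf_eq0 negb_or => /andP[/hf E /hf' ->].
by rewrite E mulgA.
Qed.

Lemma subalgebra_shifts d (D : degrees d) : subalgebra (shifts 1%g D D).
Proof.
split=> [|f f' hf hf' i r c|c f hf i r c'|f f' hf hf'].
- exact: shifts1.
- rewrite mxE; have [->|/hf->//] := eqVneq (f i r c) 0.
  by rewrite add0r => /hf'.
- by rewrite mxE mulf_eq0 negb_or => /andP[_ /hf].
- by rewrite -[1%g]mulg1; apply: shifts_comp hf hf'.
Qed.

(** A nonzero determinant has a nonzero term. *)
Lemma shifts_perm d h (D D' : degrees d) f :
  shifts h D D' f -> (forall i, \det (f i) != 0) ->
  exists s : forall i, {perm 'I_(d i)}, forall i r, D' i (s i r) = (h * D i r)%g.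
Proof.
move=> hf uf.
have H : forall i, exists s : {perm 'I_(d i)}, forall r, f i r (s r) != 0.
  2: by exists (fun i => sval (cid (H i))) => i r; apply/hf/(svalP (cid (H i))).
move=> i; have [//|all0] := pselect (exists s : {perm 'I_(d i)}, forall r, f i r (s r) != 0).
case/negP: (uf i); apply/eqP/big1 => s _.
have [r fr] : exists r, f i r (s r) = 0.
  apply: contrapT => nz; apply: all0; exists s => r.
  by apply/negP => /eqP fr; apply: nz; exists r.
by rewrite (bigD1 r) //= fr mul0r mulr0.
Qed.

End Gradings.

Section FiniteGradings.
Variables (V : finType) (A : Type) (Q : quiver V A) (K : fieldType).
Variables (G : groupType) (g : A -> G) (d : V -> nat).
Local Notation degrees := (forall i, 'I_(d i) -> G).
Hypothesis powK : idempotent_powers K.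

Lemma sum_components (D D' : degrees) : exists s : seq G, forall
    (f : forall i, 'M[K]_(d i)) i, f i = \sum_(h <- s) component h D D' f i.
Proof.
pose s := undup [seq (D' (tag x) (tagged x).2 * (D (tag x) (tagged x).1)^-1)%g |
   x <- enum {: {i : V & ('I_(d i) * 'I_(d i))%type}}].
exists s => f i; apply/matrixP => r c; rewrite summxE.
pose h := (D' i c * (D i r)^-1)%g.
have hs : h \in s.
  rewrite mem_undup; apply/mapP.
  by exists (Tagged (fun i => ('I_(d i) * 'I_(d i))%type) (r, c)); rewrite ?mem_enum.
rewrite (bigD1_seq h) ?undup_uniq //= mxE /h mulgKV eqxx big1 ?addr0 // => k kh.
rewrite mxE; case: eqP => // E; case/eqP: kh.
by rewrite /h E mulgK.
Qed.

Lemma dim_le_sum i : (d i <= \sum_j d j)%N.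
Proof. by rewrite (bigD1 i) //= leq_addr. Qed.

(** Gradings of an indecomposable representation are unique up to a shift:
    decomposing one half of an isomorphism into homogeneous components gives a
    sum of endomorphisms equal to the identity, and in a local algebra one of
    the terms has to be invertible. *)
Lemma graded_iso (M M' : rep Q K d) (D D' : degrees) :
  graded g M D -> graded g M' D' -> indecomposable M -> rep_iso M M' ->
  exists h f f', [/\ is_rep_hom M M' f, shifts h D D' f, shifts h^-1%g D' D f',
    forall i, f i *m f' i = 1%:M & forall i, f' i *m f i = 1%:M].
Proof.
move=> hM hM' /indecomposableP [nz triv] [f [f' [hf hf' ff' f'f]]].
have [i0 d0] := exists_dim_gt0 nz.
have [s Es] := sum_components D D'.
have hc h : is_rep_hom M M (fun i => component h D D' f i *m f' i).
  by apply: rep_hom_comp hf'; apply: (component_hom h hM hM' hf).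
have [h _ uh] : exists2 h, h \in s & \det (component h D D' f i0 *m f' i0) != 0.
  apply: contrapT => z; have := @det_sum_eq0 V A Q K d _ dim_le_sum powK M _
    (@subalgebraT V K d) triv i0 d0 _ s _ (fun=> I) hc.
  rewrite -mulmx_suml -Es ff' det1 => H.
  have /H/eqP : forall h, h \in s -> \det (component h D D' f i0 *m f' i0) = 0.
    by move=> h hs; apply/eqP/negPn/negP => nzh; apply: z; exists h.
  by rewrite oner_eq0.
have [N N0] := nilpotent_or_invertible dim_le_sum powK (@subalgebraT V K d) triv
  d0 I (hc h).
rewrite (negPf uh) => EN.
have ufi i : component h D D' f i \in unitmx.
  case: N N0 EN => // N _ /(_ i); rewrite exprS -!mulmxE -mulmxA.
  by case/mulmx1_unit.
pose F := component h D D' f; pose F' i := component h^-1%g D' D (fun i => invmx (F i)) i.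
have sF : shifts h D D' F by apply: component_shifts.
have FF' i : F i *m F' i = 1%:M.
  rewrite /F' (@mul_component V K G d d d h h^-1%g D D' D F _ i sF) mulVg.
  rewrite (_ : (fun i => F i *m invmx (F i)) = (fun i => 1%:M)) ?component1 //.
  by apply: functional_extensionality_dep => j; rewrite mulmxV.
exists h, F, F'; split=> //; first exact: (component_hom h hM hM' hf).
- exact: component_shifts.
- by move=> i; apply: mulmx1C.
Qed.

End FiniteGradings.

(** * Indecomposability of graded representations *)

Section GradedIndecomposable.
Variables (V : finType) (A : Type) (Q : quiver V A) (K : fieldType).
Variables (G : groupType) (g : A -> G) (d : V -> nat).
Variables (M : rep Q K d) (D : forall i, 'I_(d i) -> G).
Hypotheses (powK : idempotent_powers K) (MD : graded g M D).

(** The maps [s] need not be injective: the condition is stronger that way, and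
    still follows from the absence of small torsion in the group. *)
Definition unshiftable d' (D' : forall i : V, 'I_(d' i) -> G) :=
  forall h (s : forall i, 'I_(d' i) -> 'I_(d' i)),
  (forall i r, D' i (s i r) = (h * D' i r)%g) -> h = 1%g.

Hypotheses (noD : unshiftable D) (trivM : trivial_idempotents M (shifts 1%g D D)).
Variables (i0 : V) (d0 : (0 < d i0)%N).

Let dich f := nilpotent_or_invertible (@dim_le_sum V d) powK
  (subalgebra_shifts K D) trivM d0 (f := f).

Section Radical.
Variable i : V.
Implicit Types (F : 'M[K]_(d i)) (v : 'rV[K]_(d i)) (x y z : G).

Definition radical_block F x y (u : forall i, 'M[K]_(d i)) :=
  [/\ is_rep_hom M M u, shifts (y * x^-1)%g D D u, x = y -> \det (u i0) = 0 &
    forall r s, D r = x -> D s = y -> F r s = u i r s].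

(** The radical of the endomorphism algebra, described at the vertex [i] block by
    block. Only blocks on the diagonal carry a condition, as invertible
    homogeneous endomorphisms of nontrivial degree do not exist. *)
Definition radical_blocks F := forall x y, exists u, radical_block F x y u.

Lemma radical_blocks_add F F' :
  radical_blocks F -> radical_blocks F' -> radical_blocks (F + F').
Proof.
move=> hF hF' x y; have [u [hu su du Eu]] := hF x y.
have [u' [hu' su' du' Eu']] := hF' x y; exists (fun i => u i + u' i); split.
- exact: rep_hom_add.
- move=> j r c; rewrite mxE; have [->|/su//] := eqVneq (u j r c) 0.
  by rewrite add0r => /su'.
- move=> xy; apply: (det_add_eq0 (@dim_le_sum V d) powK (subalgebra_shifts K D) trivM d0) => //.
  + by move: su; rewrite xy mulgV.
  + by move: su'; rewrite xy mulgV.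
  + exact: du.
  + exact: du'.
- by move=> r s hr hs; rewrite !mxE Eu // Eu'.
Qed.

(** A product of two components of opposite nontrivial degrees [z x^-1] and
    [x z^-1] has degree [1], and it is no unit: its first factor would translate
    the degrees. *)
Lemma det_mul_shifts x z u u' : is_rep_hom M M u -> is_rep_hom M M u' ->
  shifts (z * x^-1)%g D D u -> shifts (x * z^-1)%g D D u' ->
  (x = z -> \det (u i0) = 0) -> \det (u i0 *m u' i0) = 0.
Proof.
move=> hu hu' su su' du; have [xz|xz] := eqVneq x z.
  by rewrite det_mulmx du // mul0r.
have suu : shifts 1%g D D (fun i => u i *m u' i).
  by have := shifts_comp su su'; rewrite mulgA mulgKV mulgV.
have [N N0] := dich suu (rep_hom_comp hu hu').
have [//|nz EN] := eqVneq (\det (u i0 *m u' i0)) 0.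
have [|s hs] := shifts_perm su.
  move=> j; rewrite -unitfE -[_ \in _]/(u j \in unitmx).
  case: N N0 EN => // N _ /(_ j); rewrite exprS -!mulmxE -mulmxA.
  by case/mulmx1_unit.
have zx : (z * x^-1)%g = 1%g by apply: (noD (s := fun i => s i)).
by case/eqP: xz; rewrite -[z](mulgKV x) zx mul1g.
Qed.

Lemma radical_blocks_mul F F' :
  radical_blocks F -> radical_blocks F' -> radical_blocks (F *m F').
Proof.
move=> hF hF' x y.
pose u z := sval (cid (hF x z)); pose u' z := sval (cid (hF' z y)).
have Hu z : radical_block F x z (u z) := svalP (cid (hF x z)).
have Hu' z : radical_block F' z y (u' z) := svalP (cid (hF' z y)).
have hu z : is_rep_hom M M (u z) by case: (Hu z).
have hu' z : is_rep_hom M M (u' z) by case: (Hu' z).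
pose Z := undup [seq D j | j <- enum 'I_(d i)].
have inZ (j : 'I_(d i)) : D j \in Z by rewrite mem_undup; apply/mapP; exists j; rewrite ?mem_enum.
exists (fun i => \sum_(z <- Z) u z i *m u' z i); split.
- apply: (@rep_hom_sum V A Q K d d M M G Z (fun z i => u z i *m u' z i)) => z.
  exact: rep_hom_comp (hu z) (hu' z).
- move=> j r c; rewrite summxE => nz.
  have [z] := sum_neq0 nz.
  case: (Hu z) (Hu' z) => _ su _ _ [_ su' _ _] /(shifts_comp su su') ->.
  by rewrite !mulgA mulgKV.
- move=> xy; apply: (@det_sum_eq0 V A Q K d _ (@dim_le_sum V d) powK M _
    (subalgebra_shifts K D) trivM i0 d0 G Z (fun z i => u z i *m u' z i)).
  + move=> z; case: (Hu z) (Hu' z) => _ su _ _ [_ su' _ _].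
    by have := shifts_comp su su'; rewrite xy mulgA mulgKV mulgV.
  + by move=> z; exact: rep_hom_comp (hu z) (hu' z).
  + move=> z _; case: (Hu z) (Hu' z) => _ su du _ [_ su' _ _].
    by apply: det_mul_shifts (hu z) (hu' z) su _ du; rewrite xy.
- move=> r s hr hs; rewrite mxE summxE.
  under [RHS]eq_bigr do rewrite mxE.
  rewrite exchange_big; apply: eq_bigr => j _.
  rewrite (bigD1_seq (D j)) ?undup_uniq //=.
  have [_ _ _ <- //] := Hu (D j); have [_ _ _ <- //] := Hu' (D j).
  rewrite big1 ?addr0 // => z zj.
  case: (Hu z) => _ su _ _.
  have [->|/su] := eqVneq (u z i r j) 0; first by rewrite mul0r.
  by rewrite hr mulgKV => E; rewrite E eqxx in zj.
Qed.

Lemma radical_blocks_sum n (F : 'I_n -> 'M[K]_(d i)) :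
  radical_blocks 0 -> (forall k, radical_blocks (F k)) -> radical_blocks (\sum_k F k).
Proof.
by move=> h0 hF; elim/big_ind: _ => //; apply: radical_blocks_add.
Qed.

Lemma radical_blocks_restrict (p q : pred G) F : radical_blocks F ->
  radical_blocks (\matrix_(r, s) (F r s *+ (p (D r) && q (D s)))).
Proof.
move=> hF x y; case E: (p x && q y); last first.
  exists (fun=> 0); split=> [a|j r c|_|r s hr hs].
  - by rewrite mulmx0 mul0mx.
  - by rewrite mxE eqxx.
  - by rewrite det_mx0.
  - by rewrite !mxE hr hs E.
have [u [hu su du Eu]] := hF x y; exists u; split=> // r s hr hs.
by rewrite mxE hr hs E Eu.
Qed.

Lemma diagonal_block_nilpotent x F : radical_blocks F ->
  exists N, (\matrix_(r, s) (F r s *+ ((D r == x) && (D s == x)))) ^+ N = 0.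
Proof.
move=> hF; have [u [hu su du Eu]] := hF x x; rewrite mulgV in su.
have [N N0] := dich su hu; rewrite du // eqxx => uN.
set C := \matrix_(r, s) _; exists N.
suff E k r s : (C ^+ k.+1) r s = (u i ^+ k.+1) r s *+ ((D r == x) && (D s == x)).
  case: N N0 uN => // N _ uN; apply/matrixP => r s.
  by rewrite E uN !mxE mul0rn.
elim: k r s => [|k IH] r s.
  by rewrite !expr1 mxE; case: eqP; case: eqP => //= hs hr; rewrite Eu.
rewrite exprS [X in _ = X *+ _](_ : _ = (u i *m u i ^+ k.+1) r s); last by rewrite exprS.
rewrite !mxE -sumrMnl; apply: eq_bigr => j _; rewrite IH !mxE.
case: eqP => [hr|_]; last by rewrite mul0r mulr0n.
have [hj|hj] := eqVneq (D j) x; first by rewrite (Eu r j) // mulrnAr.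
rewrite /= !mulr0n mul0r; have [->|/su E] := eqVneq (u i r j) 0.
  by rewrite mul0r mul0rn.
by rewrite E mul1g hr eqxx in hj.
Qed.

(** Gaussian elimination: the blocks [1 - C] on the diagonal are invertible as
    [C] is nilpotent, and elimination of the degree [x] stays in the ideal. *)
Lemma radical_fixed_vector (S : seq G) F v : radical_blocks 0 -> radical_blocks F ->
  (forall r, v 0 r != 0 -> D r \in S) ->
  (forall s, D s \in S -> (v *m F) 0 s = v 0 s) -> v = 0.
Proof.
move=> h0; elim: S F v => [|x S IH] F v hF supp fixv.
  by apply/rowP => r; rewrite mxE; apply/eqP/negPn/negP => /supp.
have [xS|xS] := boolP (x \in S).
  apply: (IH F v hF) => [r /supp|s hs]; first by rewrite inE => /orP[/eqP->|].
  by apply: fixv; rewrite inE hs orbT.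
pose vx := \row_r (v 0 r *+ (D r == x)); pose v' := \row_r (v 0 r *+ (D r != x)).
have Ev : v = vx + v'.
  by apply/rowP => r; rewrite !mxE; case: eqP; rewrite ?addr0 ?add0r.
pose B := \matrix_(r, s) (F r s *+ (predT (D r) && (D s == x))).
pose C := \matrix_(r, s) (F r s *+ ((D r == x) && (D s == x))).
have hB : radical_blocks B := radical_blocks_restrict predT (pred1 x) hF.
have hC : radical_blocks C := radical_blocks_restrict (pred1 x) (pred1 x) hF.
have [N CN] : exists N, C ^+ N = 0 := diagonal_block_nilpotent x hF.
pose H := \sum_(k < N) C ^+ k.
have CH : (1 - C) * H = 1 by rewrite -opprB mulNr -subrX1 CN sub0r opprK.
have vxC : vx *m (1 - C) = v' *m B.
  apply/rowP => s; rewrite mulmxBr mulmx1 mxE [X in _ + X = _]mxE.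
  have [hs|hs] := eqVneq (D s) x; last first.
    rewrite !mxE (negPf hs) mulr0n add0r !big1 ?oppr0 // => j _.
      by rewrite !mxE (negPf hs) andbF mulr0n mulr0.
    by rewrite !mxE (negPf hs) andbF mulr0n mulr0.
  have := fixv s; rewrite inE hs eqxx => /(_ isT) Es.
  rewrite {1}/vx mxE hs eqxx mulr1n -Es; apply/eqP; rewrite subr_eq; apply/eqP.
  rewrite !mxE -big_split; apply: eq_bigr => j _; rewrite !mxE hs eqxx /= mulr1n andbT.
  by case: eqP; rewrite /= ?mulr1n ?mulr0n ?mul0r ?mulr0 ?add0r ?addr0.
have Evx : vx = v' *m (B *m H).
  by rewrite mulmxA -vxC -mulmxA mulmxE CH mulmx1.
have hBH : radical_blocks (B *m H).
  rewrite mulmx_sumr; apply: radical_blocks_sum => // -[k /= _].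
  elim: k => [|k IHk]; first by rewrite expr0 mulmx1.
  by rewrite exprSr -mulmxE mulmxA; apply: radical_blocks_mul.
have v'0 : v' = 0.
  apply: (IH (F + B *m H *m F)).
  - by apply: radical_blocks_add => //; apply: radical_blocks_mul.
  - move=> r; rewrite mxE; case: (eqVneq (D r) x) => hr; first by rewrite eqxx.
    by move/supp; rewrite inE (negPf hr).
  - move=> s hs; have hsx : D s != x by apply: contraNneq xS => <-.
    rewrite mulmxDr !mulmxA -(mulmxA v') -Evx -mulmxDl addrC -Ev fixv ?inE ?hs ?orbT //.
    by rewrite mxE hsx.
by rewrite Ev Evx v'0 mul0mx addr0.
Qed.

End Radical.

(** [f] lies in the radical as soon as its component of degree [1] is no unit. *)
Lemma det_sub1_radical f i : is_rep_hom M M f ->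
  \det (component 1%g D D f i0) = 0 -> \det (1 - f i) != 0.
Proof.
move=> hf f0; apply/det0P => -[v nz]; rewrite mulmxBr mulmx1 => /eqP.
rewrite subr_eq0 => /eqP Ev; case/eqP: nz.
pose S := [seq D j | j <- enum 'I_(d i)].
have inS (r : 'I_(d i)) : D r \in S by apply/mapP; exists r; rewrite ?mem_enum.
apply: (@radical_fixed_vector i S (f i) v) => // [x y|x y|s _]; last by rewrite -Ev.
- exists (fun=> 0); split=> [a|j r c|_|r s hr hs].
  + by rewrite mulmx0 mul0mx.
  + by rewrite mxE eqxx.
  + by rewrite det_mx0.
  + by rewrite !mxE.
exists (component (y * x^-1)%g D D f); split.
- exact: (component_hom _ MD MD hf).
- exact: component_shifts.
- by move=> ->; rewrite mulgV.
- by move=> r s hr hs; rewrite mxE hr hs mulgKV eqxx.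
Qed.

(** The component [e1] of degree [1] of an idempotent [e] is nilpotent or
    invertible. In the first case [e] is in the radical, so [1 - e] is
    invertible and [e = 0]. In the second case [1 - e1^-1 e] is in the radical,
    so [e] is invertible and [e = 1]. *)
Lemma graded_trivial_idempotents : trivial_idempotents M (fun=> True).
Proof.
move=> e _ he ee.
pose e1 := component 1%g D D e.
have se1 : shifts 1%g D D e1 by apply: component_shifts.
have he1 : is_rep_hom M M e1 by apply: (component_hom _ MD MD he).
have [N N0] := dich se1 he1; case: eqP => [z _|_ EN].
  left=> i; have := det_sub1_radical i he z.
  rewrite -unitfE -[_ \in _]/(_ \in unitmx) => u.
  have : (1 - e i) *m e i = 0 by rewrite mulmxBl mul1mx ee subrr.
  by move/(congr1 (mulmx (invmx (1 - e i)))); rewrite mulKmx // mulmx0.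
(* [w] is the inverse of [e1]. *)
case: N N0 EN => // N _ EN; pose w i : 'M[K]_(d i) := e1 i ^+ N.
have sw : shifts 1%g D D w := subalgebra_exp (subalgebra_shifts K D) N se1.
have hw : is_rep_hom M M w := rep_hom_exp N he1.
have hf : is_rep_hom M M (fun i => 1 - w i *m e i).
  move=> a; rewrite mulmxBr mulmxBl mulmx1 mul1mx; congr (_ - _).
  exact: (rep_hom_comp hw he).
right=> i; have := det_sub1_radical i hf.
rewrite opprB addrC subrK det_mulmx mulf_eq0 negb_or.
have -> : component 1%g D D (fun i => 1 - w i *m e i) i0 = 0.
  have := @mul_component V K G d d d 1%g 1%g D D D w e i0 sw.
  have we : w i0 *m component 1%g D D e i0 = 1 by rewrite mulmxE -exprSr EN.
  rewrite mul1g we => /matrixP E.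
  apply/matrixP => r c; have := E r c; rewrite !mxE mul1g.
  case: (D c == D r) => [E1|_]; last by rewrite mulr0n.
  by rewrite E1 subrr.
rewrite det_mx0 // => /(_ erefl) /andP[_]; rewrite -unitfE -[_ \in _]/(_ \in unitmx) => u.
by have := congr1 (mulmx (invmx (e i))) (ee i); rewrite mulKmx // mulVmx.
Qed.

End GradedIndecomposable.

(** Iterating the translation by [h] on one basis vector, two of the first
    [d i0 + 1] iterates coincide, so [h] has torsion at most [d i0]. *)
Lemma unshiftable_torsion (V : finType) (G : groupType) (d : V -> nat)
    (D : forall i, 'I_(d i) -> G) i0 : (0 < d i0)%N ->
  (forall (h : G) n, (0 < n <= d i0)%N -> (h ^+ n = 1)%g -> h = 1%g) -> unshiftable D.
Proof.
move=> d0 tors h s hs; pose r0 := Ordinal d0.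
have iterE m : D i0 (iter m (@s i0) r0) = (h ^+ m * D i0 r0)%g.
  by elim: m => [|m IH]; rewrite ?expg0 ?mul1g // iterS hs IH mulgA -expgS.
have : ~~ injectiveb (fun j : 'I_(d i0).+1 => iter j (@s i0) r0).
  by apply/negP => /injectiveP/leq_card; rewrite !card_ord ltnn.
case/injectivePn => j [k jk Ejk].
wlog lt_jk : j k jk Ejk / (j < k)%N.
  case: (ltngtP j k) => [lt|lt|/val_inj E] W; first exact: W Ejk lt.
  - by apply: W (esym Ejk) lt; rewrite eq_sym.
  - by rewrite E eqxx in jk.
have : (h ^+ k = h ^+ j)%g.
  by have := congr1 (@D i0) Ejk; rewrite !iterE => /mulIg.
rewrite -(subnK (ltnW lt_jk)) expgnDr => E.
apply: (tors h (k - j)%N).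
  by rewrite subn_gt0 lt_jk (leq_trans (leq_subr _ _)) // -ltnS.
by apply: (mulIg (h ^+ j)%g); rewrite E mul1g.
Qed.

Section ScalarExtension.
Variables (V : finType) (A : Type) (Q : quiver V A) (F : finFieldType).
Variables (d : V -> nat) (M : rep Q F d).

Lemma absolutely_indecomposableP : absolutely_indecomposable M <->
  ~ (forall i, d i = 0%N) /\
  forall K : fieldExtType F, trivial_idempotents (extend_scalars K M) (fun=> True).
Proof.
split=> [H|[nz H] K]; last by apply/indecomposableP.
split=> [|K]; first by case: (H (F^o : fieldExtType F)).
by have /indecomposableP [] := H K.
Qed.

Lemma graded_extend (G : groupType) (g : A -> G) (D : forall i, 'I_(d i) -> G)
    (K : fieldExtType F) : graded g M D -> graded g (extend_scalars K M) D.
Proof. by move=> MD a r c; rewrite mxE fmorph_eq0; apply: MD. Qed.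

Lemma graded_absolutely_indecomposable (G : groupType) (g : A -> G)
    (D : forall i, 'I_(d i) -> G) :
  graded g M D -> unshiftable D -> ~ (forall i, d i = 0%N) ->
  (forall K : fieldExtType F, trivial_idempotents (extend_scalars K M) (shifts 1%g D D)) ->
  absolutely_indecomposable M.
Proof.
move=> MD noD nz H; apply/absolutely_indecomposableP; split=> // K.
have [i0 d0] := exists_dim_gt0 nz.
exact: (@graded_trivial_idempotents V A Q K G g d _ D
  (@finext_idempotent_powers F K) (graded_extend MD) noD (H K) i0 d0).
Qed.

End ScalarExtension.

(** A representation over [F] is its own extension to the trivial field
    extension, so absolute indecomposability implies indecomposability. *)
Lemma absolutely_indecomposableW (V : finType) (A : Type) (Q : quiver V A)
    (F : finFieldType) (d : V -> nat) (M : rep Q F d) :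
  absolutely_indecomposable M -> indecomposable M.
Proof.
move/(_ (F^o : fieldExtType F)); congr (indecomposable _).
apply: functional_extensionality_dep => a; apply/matrixP => r c.
by rewrite mxE; exact: mulr1.
Qed.

(** * Twisting by a character *)

Section Twist.
Variables (V A : Type) (Q : quiver V A) (K : fieldType).
Variables (G Gb : groupType) (g : A -> G) (p : G -> Gb) (chi : G -> K).
Hypotheses (pM : {morph p : x y / (x * y)%g >-> (x * y)%g})
  (kerC : forall x y : G, p x = 1%g -> (x * y = y * x)%g)
  (chi1 : chi 1%g = 1)
  (chiM : forall x y, p x = 1%g -> p y = 1%g -> chi (x * y)%g = chi x * chi y).
Implicit Types (d : V -> nat).
Local Notation degrees d := (forall i, 'I_(d i) -> G).
Local Notation proj D := (fun i r => p (D i r)).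

(** [chi] matters only on the kernel of [p], and [cocycle x y] only for [x] and
    [y] with the same image under [p]. *)
Definition cocycle x y := chi (x^-1 * y)%g.

Lemma projection1 : p 1%g = 1%g.
Proof. by apply: (mulgI (p 1%g)); rewrite -pM !mulg1. Qed.

Lemma projectionV x : p x^-1%g = (p x)^-1%g.
Proof. by apply: (mulgI (p x)); rewrite -pM !mulgV projection1. Qed.

Lemma projection_div x y : p x = p y -> p (x^-1 * y)%g = 1%g.
Proof. by move=> E; rewrite pM projectionV E mulVg. Qed.

Lemma cocycleM x y z : p x = p y -> p y = p z ->
  cocycle x y * cocycle y z = cocycle x z.
Proof.
by move=> xy yz; rewrite /cocycle -chiM ?projection_div // -mulgA mulKVg.
Qed.

Lemma cocycle_id x : cocycle x x = 1.
Proof. by rewrite /cocycle mulVg. Qed.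

Lemma cocycle_neq0 x y : p x = p y -> cocycle x y != 0.
Proof.
move=> xy; apply/negP => /eqP z; have := cocycleM xy (esym xy).
by rewrite z mul0r cocycle_id => /esym/eqP; rewrite oner_eq0.
Qed.

Lemma cocycle_mull h x y : cocycle (h * x)%g (h * y)%g = cocycle x y.
Proof. by rewrite /cocycle invgM -mulgA mulKg. Qed.

Lemma cocycle_mulr h x y : p x = p y -> cocycle (x * h)%g (y * h)%g = cocycle x y.
Proof.
move=> xy; rewrite /cocycle invgM -mulgA (mulgA x^-1)%g.
by rewrite (kerC h (projection_div xy)) mulKg.
Qed.

(** If [M] is graded by the quotient group, an arrow respects the degrees [D] up to
    an element of the kernel of [p]; the twist multiplies each entry by the value
    of the character on that element. *)
Definition twist d (M : rep Q K d) (D : degrees d) : rep Q K d :=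
  fun a => \matrix_(r, c) (cocycle (D _ r * g a)%g (D _ c) * M a r c).

Definition twist_hom d d' h (D : degrees d) (D' : degrees d')
    (f : forall i, 'M[K]_(d i, d' i)) i : 'M[K]_(d i, d' i) :=
  \matrix_(r, c) (cocycle (h * D i r)%g (D' i c) * f i r c).

Lemma twist_graded d (M : rep Q K d) (D : degrees d) :
  graded (p \o g) M (proj D) -> graded (p \o g) (twist M D) (proj D).
Proof. by move=> MD a r c; rewrite mxE mulf_eq0 negb_or => /andP[_ /MD]. Qed.

Lemma twist_hom_rep d d' (M : rep Q K d) (M' : rep Q K d') h D D' f :
  graded (p \o g) M (proj D) -> graded (p \o g) M' (proj D') ->
  shifts (p h) (proj D) (proj D') f -> is_rep_hom M M' f ->
  is_rep_hom (twist M D) (twist M' D') (twist_hom h D D' f).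
Proof.
move=> MD MD' sf hf a; apply/matrixP => r c; have /matrixP/(_ r c) := hf a.
rewrite !mxE => E.
transitivity (cocycle (h * (D _ r * g a))%g (D' _ c) * (\sum_j M a r j * f _ j c)).
  rewrite mulr_sumr; apply: eq_bigr => j _; rewrite !mxE.
  have [->|nM] := eqVneq (M a r j) 0; first by rewrite mulr0 !mul0r mulr0.
  have [->|nf] := eqVneq (f _ j c) 0; first by rewrite !mulr0.
  have E1 := MD _ _ _ nM; have E2 := sf _ _ _ nf.
  rewrite /= in E1 E2.
  rewrite -(@cocycleM (h * (_ * _))%g (h * D _ j)%g).
  - by rewrite cocycle_mull mulrACA.
  - by rewrite !pM E1.
  - by rewrite pM E2.
rewrite E mulr_sumr; apply: eq_bigr => j _; rewrite !mxE.
have [->|nf] := eqVneq (f _ r j) 0; first by rewrite !(mulr0, mul0r).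
have [->|nM] := eqVneq (M' a j c) 0; first by rewrite !mulr0.
have E1 := MD' _ _ _ nM; have E2 := sf _ _ _ nf.
rewrite /= in E1 E2.
rewrite mulgA -(@cocycleM (_ * _ * g a)%g (D' _ j * g a)%g).
- by rewrite cocycle_mulr ?pM ?E2 // mulrACA.
- by rewrite !pM E2.
- by rewrite pM E1.
Qed.

Lemma twist_hom_comp d d' d'' h h' (D : degrees d) (D' : degrees d')
    (D'' : degrees d'') f f' i :
  shifts (p h) (proj D) (proj D') f -> shifts (p h') (proj D') (proj D'') f' ->
  twist_hom h D D' f i *m twist_hom h' D' D'' f' i =
  twist_hom (h' * h)%g D D'' (fun i => f i *m f' i) i.
Proof.
move=> sf sf'; apply/matrixP => r c; rewrite !mxE mulr_sumr; apply: eq_bigr => j _.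
rewrite !mxE; have [->|nf] := eqVneq (f i r j) 0; first by rewrite !(mulr0, mul0r).
have [->|nf'] := eqVneq (f' i j c) 0; first by rewrite !mulr0.
have E1 := sf _ _ _ nf; have E2 := sf' _ _ _ nf'.
rewrite -mulgA -(@cocycleM (h' * (h * _))%g (h' * D' i j)%g).
- by rewrite cocycle_mull mulrACA.
- by rewrite !pM E1.
- by rewrite pM E2.
Qed.

Lemma twist_hom1 d (D : degrees d) i : twist_hom 1%g D D (fun=> 1%:M) i = 1%:M.
Proof.
apply/matrixP => r c; rewrite !mxE mul1g.
by case: eqVneq => [->|_]; rewrite ?mulr0 // cocycle_id mulr1.
Qed.

Lemma twist_id d (M : rep Q K d) (D : degrees d) : graded g M D -> twist M D = M.
Proof.
move=> MD; apply: functional_extensionality_dep => a; apply/matrixP => r c.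
rewrite mxE; have [->|/MD ->] := eqVneq (M a r c) 0; first by rewrite mulr0.
by rewrite cocycle_id mul1r.
Qed.

End Twist.

(** * Endomorphisms of absolutely indecomposable representations *)

(** [B] commutes with the scalar [x], so the identity follows from the one in the
    commutative ring of polynomials. *)
Lemma mx_pchar_expB (K : fieldType) p s n (B : 'M[K]_n) (x : K) : p \in [pchar K] ->
  (B - x%:M) ^+ (p ^ s) = B ^+ (p ^ s) - (x ^+ (p ^ s))%:M.
Proof.
move=> pK; case: n B => [|n] B; first by rewrite !flatmx0.
have pP : p \in [pchar {poly K}] by rewrite pchar_lalg.
have psP : ([pchar {poly K}]).-nat (p ^ s)%N.
  by rewrite (eq_pnat _ (pcharf_eq pP)) pnatX pnat_id ?(pcharf_prime pK).
have E : ('X - x%:P) ^+ (p ^ s) = 'X^(p ^ s) - (x ^+ (p ^ s))%:P :> {poly K}.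
  by rewrite exprDn_pchar // exprNn_pchar // rmorphXn.
have := congr1 (horner_mx B) E.
by rewrite rmorphXn !rmorphB /= horner_mx_X !horner_mx_C rmorphXn /= horner_mx_X.
Qed.

(** Over an extension containing an eigenvalue [x] of [f], the endomorphism
    [f - x] is not invertible, hence nilpotent; a high power of the Frobenius
    then kills it, and makes a power of [f] scalar. *)
Lemma absolutely_indecomposable_scalar (V : finType) (A : Type) (Q : quiver V A)
    (F : finFieldType) (d : V -> nat) (M : rep Q F d) p f :
  absolutely_indecomposable M -> is_rep_hom M M f -> p \in [pchar F] ->
  exists s c, forall i, f i ^+ (p ^ s) = c%:M.
Proof.
move=> /absolutely_indecomposableP [nz triv] hf pF.
have [i0 d0] := exists_dim_gt0 nz.
have nzc : char_poly (f i0) != 0 by rewrite monic_neq0 ?char_poly_monic.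
have [K [zs Ezs _]] := FinSplittingFieldFor nzc.
have [x xr] : exists x : K, root (char_poly (map_mx (GRing.in_alg K) (f i0))) x.
  rewrite -map_char_poly; case: zs Ezs => [|x zs] Ezs.
    have := eqp_size Ezs; rewrite big_nil size_poly1 size_map_poly size_char_poly.
    by case=> z; rewrite z in d0.
  by exists x; rewrite (eqp_root Ezs) big_cons rootM root_XsubC eqxx.
have hx : is_rep_hom (extend_scalars K M) (extend_scalars K M)
    (fun i => map_mx (GRing.in_alg K) (f i) - x%:M).
  move=> a; rewrite mulmxBr mulmxBl /extend_scalars -!map_mxM hf.
  by congr (_ - _); rewrite scalar_mxC.
have [m m0] := nilpotent_or_invertible (@dim_le_sum V d)
  (@finext_idempotent_powers F K) (@subalgebraT V K d) (triv K) d0 I hx.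
have -> : \det (map_mx (GRing.in_alg K) (f i0) - x%:M) == 0.
  move: xr; rewrite -eigenvalue_root_char => /eigenvalueP [v Ev nv].
  by apply/det0P; exists v => //; rewrite mulmxBr Ev mul_mx_scalar subrr.
move=> nil; have p1 := prime_gt1 (pcharf_prime pF).
have pK : p \in [pchar K] by rewrite pchar_lalg.
pose s := m; have ms : (m <= p ^ s)%N by apply/ltnW/ltn_expl.
have powE i : map_mx (GRing.in_alg K) (f i ^+ (p ^ s)) = (x ^+ (p ^ s))%:M.
  apply/eqP; rewrite -subr_eq0; apply/eqP.
  transitivity ((map_mx (GRing.in_alg K) (f i) - x%:M) ^+ (p ^ s)).
    rewrite mx_pchar_expB //; congr (_ - _).
    elim: (p ^ s)%N => [|k IH]; first by rewrite !expr0 map_mx1.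
    by rewrite !exprS -IH -!mulmxE map_mxM.
  by rewrite -(subnK ms) exprD nil mulr0.
pose c := (f i0 ^+ (p ^ s)) (Ordinal d0) (Ordinal d0).
have xc : x ^+ (p ^ s) = GRing.in_alg K c.
  have /matrixP/(_ (Ordinal d0) (Ordinal d0)) := powE i0.
  by rewrite !mxE eqxx mulr1n.
exists s, c => i; apply: (@map_mx_inj _ _ (GRing.in_alg K)).
by rewrite powE xc map_scalar_mx.
Qed.

Lemma root_of_order (F : finFieldType) l : prime l -> (l %| #|F|.-1)%N ->
  exists z : F, l.-primitive_root z.
Proof.
move=> pl ldvd; have ldvd' : (l %| #|[set: {unit F}]%G|)%N by rewrite card_finField_unit.
have [u _ ou] := Cauchy pl ldvd'; exists (val u); apply/andP; split.
  exact: prime_gt0.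
apply/forallP => i; rewrite unity_rootE -FinRing.val_unitX -FinRing.val_unit1 (inj_eq val_inj).
rewrite -order_dvdn ou.
have [->|ne] := eqVneq i.+1 l; first by rewrite dvdnn.
by rewrite gtnNdvd // ltn_neqAle ne ltn_ord.
Qed.

Lemma diagonalizable_unity_root (F : fieldType) n (B : 'M[F]_n) l (z : F) :
  l.-primitive_root z -> B ^+ l = 1 -> diagonalizable B.
Proof.
case: n B => [|n] B pz Bl; first by rewrite flatmx0; apply: diagonalizable0.
apply/diagonalizableP; exists [seq z ^+ i | i <- iota 0 l].
  rewrite map_inj_in_uniq ?iota_uniq // => i j.
  rewrite !mem_iota /= add0n => il jl /eqP; rewrite (eq_prim_root_expr pz).
  by rewrite !modn_small // => /eqP.
have := factor_Xn_sub_1 pz; rewrite big_map /index_iota subn0 => ->.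
apply: mxminpoly_min.
by rewrite rmorphB /= rmorphXn /= horner_mx_X Bl rmorph1 subrr.
Qed.

(** * Central extensions of the grading group *)

Lemma scalar_mx_exp (R : fieldType) n (x : R) k :
  (x%:M : 'M[R]_n) ^+ k = (x ^+ k)%:M.
Proof.
elim: k => [|k IH]; first by rewrite !expr0.
by rewrite !exprS IH -mulmxE -scalar_mxM.
Qed.

Lemma scale_mx_exp (R : fieldType) n (x : R) (B : 'M[R]_n) k :
  (x *: B) ^+ k = x ^+ k *: B ^+ k.
Proof.
elim: k => [|k IH]; first by rewrite !expr0 scale1r.
by rewrite !exprS IH -!mulmxE -scalemxAl -scalemxAr scalerA.
Qed.

Section CentralExtension.
Variables (V : finType) (A : Type) (Q : quiver V A) (F : finFieldType).
Variables (d : V -> nat) (G Gb : groupType) (g : A -> G) (p : G -> Gb).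
Variables (chi : G -> F) (l : nat) (zeta : F).
Hypotheses (pM : {morph p : x y / (x * y)%g >-> (x * y)%g})
  (p_surj : forall y, exists x, p x = y)
  (kerC : forall x y : G, p x = 1%g -> (x * y = y * x)%g)
  (chi1 : chi 1%g = 1)
  (chiM : forall x y, p x = 1%g -> p y = 1%g -> chi (x * y)%g = chi x * chi y)
  (chi_inj : forall x, p x = 1%g -> chi x = 1 -> x = 1%g)
  (chi_order : forall x, p x = 1%g -> chi x ^+ l = 1)
  (chi_surj : forall u, u ^+ l = 1 -> exists2 x, p x = 1%g & chi x = u).
Hypotheses (pr_l : prime l) (zeta_prim : l.-primitive_root zeta)
  (dl : forall i, (d i < l)%N).
Local Notation degrees := (forall i, 'I_(d i) -> G).
Local Notation proj D := (fun i r => p (D i r)).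

(** A homogeneous isomorphism, which exists by uniqueness of gradings, can itself
    be twisted: so the class of the twist depends neither on the grading of [M]
    nor on the lift [D] of its degrees. *)
Lemma twist_iso (M M' : rep Q F d) (D D' : degrees) :
  graded (p \o g) M (proj D) -> graded (p \o g) M' (proj D') ->
  indecomposable M -> rep_iso M M' -> rep_iso (twist g chi M D) (twist g chi M' D').
Proof.
move=> MD MD' indM iM.
have [hb [f [f' [hf sf sf' ff' f'f]]]] :=
  graded_iso (@finField_idempotent_powers F) MD MD' indM iM.
have [h Eh] := p_surj hb; rewrite -Eh in sf sf'.
have ph' : p h^-1%g = (p h)^-1%g by apply: projectionV.
have hf' := rep_hom_inv hf ff' f'f.
exists (twist_hom chi h D D' f), (twist_hom chi h^-1%g D' D f'); split.
- exact: (twist_hom_rep pM kerC chiM MD MD' sf hf).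
- by apply: (twist_hom_rep pM kerC chiM MD' MD _ hf'); rewrite ph'.
- move=> i; rewrite (twist_hom_comp pM chiM i sf) ?ph' // mulVg.
  by rewrite (functional_extensionality_dep ff') twist_hom1.
- move=> i; rewrite (twist_hom_comp pM chiM i _ sf) ?ph' // mulgV.
  by rewrite (functional_extensionality_dep f'f) twist_hom1.
Qed.

(** Twisting back turns a homogeneous idempotent of a twist into one of the
    original representation; the twist itself is no functor on ungraded
    homomorphisms, so this relies on the graded criterion. *)
Lemma twist_absolutely_indecomposable (M : rep Q F d) (D : degrees) :
  graded (p \o g) M (proj D) -> unshiftable (proj D) ->
  absolutely_indecomposable M -> absolutely_indecomposable (twist g chi M D).
Proof.
move=> MD noD /absolutely_indecomposableP [nz triv].
apply: (graded_absolutely_indecomposable (twist_graded MD) noD nz) => K e se he ee.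
pose chi' x : K := (GRing.in_alg K (chi x))^-1.
have chi'1 : chi' 1%g = 1 by rewrite /chi' chi1 rmorph1 invr1.
have chi'M x y : p x = 1%g -> p y = 1%g -> chi' (x * y)%g = chi' x * chi' y.
  by move=> px py; rewrite /chi' chiM // rmorphM invfM.
pose M' := twist g chi' (extend_scalars K (twist g chi M D)) D.
have EM : M' = extend_scalars K M.
  apply: functional_extensionality_dep => a; apply/matrixP => r c.
  rewrite !mxE; have [->|nM] := eqVneq (M a r c) 0; first by rewrite !rmorph0 !mulr0 rmorph0 mulr0.
  rewrite rmorphM mulrA mulVf ?mul1r // fmorph_eq0.
  apply: (cocycle_neq0 pM chi1 chiM); rewrite pM; exact/esym/(MD _ _ _ nM).
have MKD : graded (p \o g) (extend_scalars K (twist g chi M D)) (proj D).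
  exact/graded_extend/twist_graded.
have sep : shifts (p 1%g) (proj D) (proj D) e by rewrite (projection1 pM).
have he' : is_rep_hom (extend_scalars K M) (extend_scalars K M) (twist_hom chi' 1%g D D e).
  rewrite -EM; exact: (twist_hom_rep pM kerC chi'M MKD MKD sep he).
have nz_chi' i r c : e i r c != 0 -> cocycle chi' (1 * D i r)%g (D i c) != 0.
  move=> nze; apply: (cocycle_neq0 pM chi'1 chi'M).
  by rewrite mul1g; have := se _ _ _ nze; rewrite mul1g.
have [|z|u] := triv K _ I he'.
- move=> i; rewrite (twist_hom_comp pM chi'M i sep sep) mul1g.
  by rewrite (functional_extensionality_dep ee).
- left=> i; apply/matrixP => r c; have /matrixP/(_ r c) := z i.
  rewrite !mxE => /eqP; rewrite mulf_eq0 => /orP[E|/eqP->//].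
  by apply/eqP/negPn/negP => /nz_chi'; rewrite E.
- right=> i; apply/matrixP => r c; have /matrixP/(_ r c) := u i.
  rewrite !mxE; have [->|ne] := eqVneq r c.
    by rewrite mul1g cocycle_id // mul1r.
  move/eqP; rewrite mulf_eq0 => /orP[E|/eqP->//].
  by apply/eqP/negPn/negP => /nz_chi'; rewrite E.
Qed.


Lemma coprime_inverse a b : (0 < a)%N -> coprime a b ->
  exists u v, (a * u = 1 + v * b)%N.
Proof.
move=> a0 /(coprimeP _ a0) [[u v] /= E]; exists u, v.
by rewrite mulnC -E subnK // ltnW // -subn_gt0 E.
Qed.

Lemma twist_eq (chi' : G -> F) (M : rep Q F d) (D : degrees) :
  graded (p \o g) M (proj D) -> (forall x, p x = 1%g -> chi' x = chi x) ->
  twist g chi' M D = twist g chi M D.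
Proof.
move=> MD E; apply: functional_extensionality_dep => a; apply/matrixP => r c.
rewrite !mxE; have [->|/MD nM] := eqVneq (M a r c) 0; first by rewrite !mulr0.
by rewrite /cocycle E // (projection_div pM) // pM nM.
Qed.

Lemma chi_injective x y : p x = 1%g -> p y = 1%g -> chi x = chi y -> x = y.
Proof.
move=> px py E; have pV := projectionV pM.
have pxy : p (x * y^-1)%g = 1%g by rewrite pM pV px py mulgV.
suff /(congr1 (mulg^~ y)) : (x * y^-1)%g = 1%g by rewrite /= mulgKV mul1g.
apply: chi_inj => //; have nz : chi y != 0.
  by rewrite -(mul1g y) -[1%g]invg1 (@cocycle_neq0 F G Gb p chi pM chi1 chiM) // (projection1 pM).
apply: (mulIf nz); rewrite -chiM // mulgKV mul1r //.
Qed.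

(** An isomorphism [f] of [M] with its twist is homogeneous of degree [1]. By
    absolute indecomposability [f ^ l] is scalar up to a power prime to [l], and
    the bound on the dimensions makes that scalar an [l]-th power, through the
    determinant at a vertex. So a power of [f] can be rescaled to have order [l]. *)
Lemma twist_fixed_order (M : rep Q F d) (D : degrees) :
  graded (p \o g) M (proj D) -> unshiftable (proj D) -> absolutely_indecomposable M ->
  rep_iso M (twist g chi M D) ->
  exists (sg : Gb -> G) (f : forall i, 'M[F]_(d i)),
    let D1 i r := sg (p (D i r)) in
    [/\ forall y, p (sg y) = y, is_rep_hom M (twist g chi M D1) f,
      shifts 1%g (proj D) (proj D) f & forall i, f i ^+ l = 1].
Proof.
move=> MD0 noD0 aiM isoM0.
have indM := absolutely_indecomposableW aiM.
pose sg y := sval (cid (p_surj y)); have sgK y : p (sg y) = y := svalP (cid (p_surj y)).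
pose D1 : degrees := fun i r => sg (p (D i r)).
have D1E : proj D1 = proj D by apply: functional_extensionality_dep => i; apply: funext => r; rewrite sgK.
have MD : graded (p \o g) M (proj D1) by rewrite D1E.
have noD : unshiftable (proj D1) by rewrite D1E.
have isoM : rep_iso M (twist g chi M D1).
  exact: rep_iso_trans isoM0 (twist_iso MD0 MD indM (rep_iso_refl M)).
have [h [f [f' [hf sf _ ff' _]]]] := graded_iso (@finField_idempotent_powers F)
  MD (twist_graded MD) indM isoM.
have uf i : f i \in unitmx by have /mulmx1_unit[] := ff' i.
have h1 : h = 1%g.
  have [i|s hs] := shifts_perm sf; first by have := uf i; rewrite unitmxE unitfE.
  exact: (noD h (fun i => s i)).
rewrite {}h1 in sf.
have D1eq i r c : f i r c != 0 -> D1 i c = D1 i r.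
  by move/sf; rewrite mul1g !sgK /D1 => ->.
(* The powers of [f] relate [M] to its successive twists, and [chi ^ l = 1]. *)
have powM n : is_rep_hom M (twist g (fun x => chi x ^+ n) M D1) (fun i => f i ^+ n).
  elim: n => [|n IH].
    suff -> : twist g (fun x => chi x ^+ 0) M D1 = M by apply: rep_hom_id.
    by apply: functional_extensionality_dep => a; apply/matrixP=> r c; rewrite mxE mul1r.
  have chinM x y : p x = 1%g -> p y = 1%g -> chi (x * y)%g ^+ n = chi x ^+ n * chi y ^+ n.
    by move=> px py; rewrite chiM // exprMn.
  have sf1 : shifts (p 1%g) (proj D1) (proj D1) f by rewrite (projection1 pM).
  have := twist_hom_rep (chi := fun x => chi x ^+ n) pM kerC chinM MD (twist_graded MD) sf1 hf.
  have -> : twist_hom (fun x => chi x ^+ n) 1%g D1 D1 f = f.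
    apply: functional_extensionality_dep => i; apply/matrixP => r c.
    rewrite mxE; have [->|/D1eq ->] := eqVneq (f i r c) 0; first by rewrite mulr0.
    by rewrite mul1g cocycle_id ?mul1r // chi1 expr1n.
  have -> : twist g (fun x => chi x ^+ n) (twist g chi M D1) D1 =
      twist g (fun x => chi x ^+ n.+1) M D1.
    apply: functional_extensionality_dep => a; apply/matrixP=> r c.
    by rewrite !mxE mulrA /cocycle exprSr.
  move=> hfn a; have := rep_hom_comp IH hfn a.
  by rewrite !exprSr.
have chi_modl n x : p x = 1%g -> chi x ^+ (1 + n * l) = chi x.
  by move=> px; rewrite exprD expr1 mulnC exprM chi_order // expr1n mulr1.
have [q pr_q qF] := finPcharP F.
have homl : is_rep_hom M M (fun i => f i ^+ l).
  move: (powM l); congr is_rep_hom.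
  apply: functional_extensionality_dep => a; apply/matrixP=> r c.
  rewrite mxE; have [->|/MD nM] := eqVneq (M a r c) 0; first by rewrite mulr0.
  by rewrite /cocycle chi_order ?mul1r // (projection_div pM) // pM nM.
have [s [c Ec]] := absolutely_indecomposable_scalar aiM homl qF.
have cop : coprime (q ^ s) l.
  rewrite coprimeXl // coprime_sym prime_coprime // dvdn_prime2 //.
  apply/negP => /eqP lq.
  by have := prim_root_pcharF zeta_prim (dvdnn l); rewrite {1}lq qF.
have qs0 : (0 < q ^ s)%N by rewrite expn_gt0 prime_gt0.
have [u [v Euv]] := coprime_inverse qs0 cop.
have [nz _] := indM.
have [i0 d0] := exists_dim_gt0 nz.
(* [q ^ s * u] is [1] modulo [l], so [f1] still relates [M] to its first twist. *)
pose f1 i : 'M[F]_(d i) := f i ^+ (q ^ s * u).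
have f1l i : f1 i ^+ l = (c ^+ u)%:M.
  by rewrite /f1 -exprM mulnAC (mulnC _ l) !exprM Ec scalar_mx_exp.
have hf1 : is_rep_hom M (twist g chi M D1) f1.
  have := powM (q ^ s * u)%N; rewrite Euv /f1 Euv.
  by rewrite (twist_eq MD (chi_modl v)).
have copd : coprime (d i0) l.
  by rewrite coprime_sym prime_coprime // gtnNdvd.
have [u1 [v1 Euv1]] := coprime_inverse d0 copd.
have detf1 : \det (f1 i0) ^+ l = (c ^+ u) ^+ d i0.
  by rewrite -det_expmx f1l det_scalar.
have c0 : c ^+ u != 0.
  apply/negP => /eqP cu0; move: detf1.
  rewrite cu0 expr0n gtn_eqF // => /eqP; rewrite expf_eq0 => /andP[_].
  rewrite det_expmx expf_eq0 => /andP[_]; apply/negP.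
  by have := uf i0; rewrite unitmxE unitfE.
(* As [d i0] is prime to [l], [c ^ u] is an [l]-th power because its [d i0]-th
   power, the determinant of [f1 ^ l], is one. *)
pose c1 := \det (f1 i0) ^+ u1 / (c ^+ u) ^+ v1.
have c1l : c1 ^+ l = c ^+ u.
  have E : (\det (f1 i0) ^+ u1) ^+ l = (c ^+ u) ^+ (d i0 * u1).
    by rewrite -exprM mulnC exprM detf1 [RHS]exprM.
  by rewrite expr_div_n E Euv1 exprD expr1 [_ ^+ (v1 * l)]exprM mulfK // (expf_neq0 _ (expf_neq0 _ c0)).
have c10 : c1 != 0.
  by move: c0; rewrite -c1l expf_eq0 prime_gt0.
exists sg, (fun i => c1^-1 *: f1 i); split=> //.
- exact: rep_hom_scale.
- have [_ _ PZ _] := subalgebra_shifts F (proj D1).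
  rewrite -D1E; apply: PZ; exact: (subalgebra_exp (subalgebra_shifts F _)).
- by move=> i; rewrite scale_mx_exp f1l exprVn c1l -scalemx1 scalerA mulVf // scale1r.
Qed.

(** In a basis diagonalizing both [f] and the [Gb]-grading, the eigenvalues of
    [f] are values of the character [chi]: they provide the component of the
    degree along the kernel of [p]. *)
Lemma twist_fixed_gradable (M : rep Q F d) (D : degrees) :
  graded (p \o g) M (proj D) -> unshiftable (proj D) -> absolutely_indecomposable M ->
  rep_iso M (twist g chi M D) -> gradable g M.
Proof.
move=> MD noD aiM isoM.
have [sg [f [sgK hf sf fl]]] := twist_fixed_order MD noD aiM isoM.
pose Db i r := p (D i r).
(* Distinct degrees at a vertex are fewer than [l], so that powers of [zeta]
   can label them and turn the grading into a diagonal matrix. *)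
pose e i r := zeta ^+ index (Db i r) [seq Db i r | r <- enum 'I_(d i)].
have e_inj i r c : e i r = e i c -> Db i r = Db i c.
  have inDb s : Db i s \in [seq Db i r | r <- enum 'I_(d i)].
    by apply/mapP; exists s; rewrite ?mem_enum.
  have lt s : (index (Db i s) [seq Db i r | r <- enum 'I_(d i)] < l)%N.
    apply: leq_ltn_trans (index_size _ _) _.
    by rewrite size_map size_enum_ord.
  move=> /eqP; rewrite (eq_prim_root_expr zeta_prim) !modn_small // => /eqP E.
  by rewrite -(nth_index (Db i r) (inDb r)) E nth_index.
have [P HP] : exists P : forall i, 'M[F]_(d i), forall i, P i \in unitmx /\
    exists b e', P i *m f i = diag_mx b *m P i /\
      P i *m diag_mx (\row_r e i r) = diag_mx e' *m P i.
  suff H i : exists P : 'M[F]_(d i), P \in unitmx /\ exists b e',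
      P *m f i = diag_mx b *m P /\ P *m diag_mx (\row_r e i r) = diag_mx e' *m P.
    by exists (fun i => sval (cid (H i))) => i; apply: (svalP (cid (H i))).
  have [] := (@codiagonalizableP F (d i) [:: f i; diag_mx (\row_r e i r)]).1.
    have comm : f i *m diag_mx (\row_r e i r) = diag_mx (\row_r e i r) *m f i.
      apply/matrixP => r c; rewrite mul_mx_diag mul_diag_mx !mxE mulrC.
      have [->|/sf E] := eqVneq (f i r c) 0; first by rewrite !mulr0.
      by rewrite /e /Db E mul1g.
    split=> [B C|B]; rewrite !inE.
      by move=> /orP[] /eqP-> /orP[] /eqP->; rewrite /comm_mx ?comm.
    move=> /orP[] /eqP->; last exact: diagonalizable_diag.
    exact: diagonalizable_unity_root zeta_prim (fl i).
  move=> P uP /= /and3P[/(similar_diagPex) [b /(similarP uP) Eb]].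
  move=> /(similar_diagPex) [e' /(similarP uP) Ee] _.
  by exists P; split=> //; exists b, e'.
have uP i : P i \in unitmx by case: (HP i).
have Pe i r s s' : P i r s != 0 -> P i r s' != 0 -> Db i s = Db i s'.
  have [_ [b [e' [_ Ee]]]] := HP i.
  have eE t : P i r t != 0 -> e i t = e' 0 r.
    move=> nz; have /matrixP/(_ r t) := Ee.
    by rewrite mul_mx_diag mul_diag_mx !mxE [e' 0 r * _]mulrC => /(mulfI nz).
  by move=> /eE E /eE E'; apply: e_inj; rewrite E E'.
have row_nz i r : exists s, P i r s != 0.
  apply: contrapT => all0; have : row r (P i) = 0.
    apply/rowP => s; rewrite !mxE; apply/eqP/negPn/negP => nz.
    by apply: all0; exists s.
  move/(congr1 (mulmx^~ (invmx (P i)))); rewrite /= -row_mul mulmxV // mul0mx.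
  by move/rowP/(_ r); rewrite !mxE eqxx => /eqP; rewrite oner_eq0.
pose s0 i r := sval (cid (row_nz i r)).
have s0P i r : P i r (s0 i r) != 0 := svalP (cid (row_nz i r)).
(* The [Gb]-degrees in the new basis. *)
pose Dn i r := Db i (s0 i r).
have PD i r s : P i r s != 0 -> Db i s = Dn i r by move=> nz; apply: Pe nz (s0P i r).
have PVD i s r : invmx (P i) s r != 0 -> Db i s = Dn i r.
  have [_ [b [e' [_ Ee]]]] := HP i.
  have Ee' : diag_mx (\row_r e i r) *m invmx (P i) = invmx (P i) *m diag_mx e'.
    rewrite -[LHS]mul1mx -(mulVmx (uP i)) -!mulmxA [P i *m (_ *m _)]mulmxA Ee.
    by rewrite -!mulmxA mulmxV // mulmx1.
  move=> nz; apply: e_inj; transitivity (e' 0 r).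
    have /matrixP/(_ s r) := Ee'.
    by rewrite mul_mx_diag mul_diag_mx !mxE [e i s * _]mulrC => /(mulfI nz).
  have /matrixP/(_ r (s0 i r)) := Ee.
  by rewrite mul_mx_diag mul_diag_mx !mxE [e' 0 r * _]mulrC => /(mulfI (s0P i r)) ->.
have [b Eb] : exists b : forall i, 'rV[F]_(d i), forall i, P i *m f i = diag_mx (b i) *m P i.
  suff H i : exists b, P i *m f i = diag_mx b *m P i.
    by exists (fun i => sval (cid (H i))) => i; apply: (svalP (cid (H i))).
  by have [_ [b [_ [Eb _]]]] := HP i; exists b.
have bl i r : b i 0 r ^+ l = 1.
  have E k : P i *m f i ^+ k = diag_mx (b i) ^+ k *m P i.
    elim: k => [|k IH]; first by rewrite !expr0 mulmx1 mul1mx.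
    by rewrite exprSr -mulmxE mulmxA IH -mulmxA Eb mulmxA exprSr -mulmxE.
  have bE k : diag_mx (b i) ^+ k = diag_mx (\row_r b i 0 r ^+ k).
    elim: k => [|k IH]; first by apply/matrixP => j t; rewrite !mxE expr0.
    rewrite exprS IH; apply/matrixP => j t; rewrite -mulmxE mul_diag_mx !mxE.
    by rewrite mulrnAr exprS.
  have /matrixP/(_ r (s0 i r)) := E l; rewrite fl bE mulmx1 mul_diag_mx !mxE.
  by move/esym/eqP; rewrite -{2}[P i r _]mul1r (inj_eq (mulIf (s0P i r))) => /eqP.
pose z i r := s2val (cid2 (chi_surj (bl i r))).
have pz i r : p (z i r) = 1%g := s2valP (cid2 (chi_surj (bl i r))).
have cz i r : chi (z i r) = b i 0 r := s2valP' (cid2 (chi_surj (bl i r))).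
pose N : rep Q F d := fun a => P _ *m M a *m invmx (P _).
have isoMN : rep_iso M N.
  apply: (@rep_iso_unit V A Q F d M N (fun i => invmx (P i))) => [a|i]; last by rewrite unitmx_inv.
  by rewrite /N !mulmxA mulVmx // mul1mx.
have conj_nz a r c (X : rep Q F d) :
  (forall r c, X a r c != 0 -> p (D _ c) = (p (D _ r) * p (g a))%g) ->
  (P _ *m X a *m invmx (P _)) r c != 0 -> Dn _ c = (Dn _ r * p (g a))%g.
  move=> HX; rewrite mxE => nz.
  have [t] := sum_neq0 nz.
  rewrite mulf_eq0 negb_or mxE => /andP[/sum_neq0 [s] + /PVD <-].
  by rewrite mulf_eq0 negb_or => /andP[/PD <- /HX].
pose tM := twist g chi M (fun i r => sg (p (D i r))).
have NtM a r c : (P _ *m tM a *m invmx (P _)) r c =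
    cocycle chi (sg (Dn _ r) * g a)%g (sg (Dn _ c)) * N a r c.
  rewrite /N !mxE mulr_sumr; apply: eq_bigr => t _.
  have [->|/PVD Et] := eqVneq (invmx (P _) t c) 0; first by rewrite !mulr0.
  rewrite mulrA; congr (_ * _); rewrite !mxE mulr_sumr; apply: eq_bigr => s _.
  have [->|/PD Es] := eqVneq (P _ r s) 0; first by rewrite !mul0r mulr0.
  by rewrite mxE -Es -Et /Db mulrCA.
have Nb a r c : N a r c * b _ 0 c =
    b _ 0 r * (cocycle chi (sg (Dn _ r) * g a)%g (sg (Dn _ c)) * N a r c).
  have : N a *m diag_mx (b _) = diag_mx (b _) *m (P _ *m tM a *m invmx (P _)).
    have E1 i : f i *m invmx (P i) = invmx (P i) *m diag_mx (b i).
      rewrite -[LHS]mul1mx -(mulVmx (uP i)) -!mulmxA [P i *m (_ *m _)]mulmxA Eb.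
      by rewrite -!mulmxA mulmxV // mulmx1.
    rewrite /N -!mulmxA -E1 [M a *m _]mulmxA hf !mulmxA Eb.
    by rewrite -!mulmxA.
  by move/matrixP/(_ r c); rewrite mul_mx_diag mul_diag_mx [LHS]mxE [RHS]mxE NtM.
exists N, (fun i r => (sg (Dn i r) * (z i r)^-1)%g); split=> // a r c nz.
have ED : Dn _ c = (Dn _ r * p (g a))%g by apply: (conj_nz a r c M) => // s t /MD.
set x := ((sg (Dn _ r) * g a)^-1 * sg (Dn _ c))%g.
have px : p x = 1%g by rewrite /x (projection_div pM) // pM !sgK ED.
have zx : z _ c = (z _ r * x)%g.
  apply: chi_injective; [exact: pz | by rewrite pM pz px mulg1 |].
  rewrite chiM ?pz ?px // !cz.
  have := Nb a r c; rewrite mulrC mulrA => /(mulIf nz) ->.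
  by rewrite /cocycle -/x.
rewrite zx invgM /x invgM invgK !mulgA mulgV mul1g.
by rewrite -!mulgA; congr (_ * _)%g; apply/esym/kerC; rewrite (projectionV pM) pz invg1.
Qed.

End CentralExtension.

(** * Counting gradable classes modulo a prime *)

Lemma absolutely_indecomposable_iso (V A : Type) (Q : quiver V A) (k : fieldType)
    d (M N : rep Q k d) :
  rep_iso M N -> absolutely_indecomposable M -> absolutely_indecomposable N.
Proof.
move=> [f [f' [hf hf' ff' f'f]]] aiM K.
have isoK : rep_iso (extend_scalars K M) (extend_scalars K N).
  exists (fun i => map_mx (GRing.in_alg K) (f i)), (fun i => map_mx (GRing.in_alg K) (f' i)).
  split=> [a|a|i|i].
  - by rewrite /extend_scalars -!map_mxM hf.
  - by rewrite /extend_scalars -!map_mxM hf'.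
  - by rewrite -map_mxM ff' map_mx1.
  - by rewrite -map_mxM f'f map_mx1.
have [nz H] := aiM K; split=> // d1 d2 M1 M2 iN; apply: (H _ _ M1 M2).
exact: rep_iso_trans isoK iN.
Qed.

Lemma gradable_iso (V A : Type) (Q : quiver V A) (K : fieldType) (G : groupType)
    (g : A -> G) d (M N : rep Q K d) : rep_iso M N -> gradable g N -> gradable g M.
Proof. by move=> iMN [L [D [iNL LD]]]; exists L, D; split=> //; apply: rep_iso_trans iMN iNL. Qed.

(** Representatives of the isomorphism classes, so that counting takes place in
    the finite type ['I_n] and not among sets of representations. *)
Definition class_system (V A : Type) (Q : quiver V A) (k : fieldType) d n
    (R : 'I_n -> rep Q k d) :=
  [/\ forall j, absolutely_indecomposable (R j),
    forall M : rep Q k d, absolutely_indecomposable M -> exists j, rep_iso (R j) M &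
    forall j j', rep_iso (R j) (R j') -> j = j'].

Lemma isoclass_eq (V A : Type) (Q : quiver V A) (k : fieldType) d (M N : rep Q k d) :
  isoclass M = isoclass N <-> rep_iso M N.
Proof.
split=> [E|iMN].
  by have : isoclass N N by [apply: rep_iso_refl]; rewrite -E.
apply/seteqP; split=> L /=; first exact/rep_iso_trans/rep_iso_sym.
exact: rep_iso_trans.
Qed.

Lemma class_systemP (V A : Type) (Q : quiver V A) (k : fieldType) d n :
  (@absindec_classes _ _ Q k d #= `I_n)%card ->
  exists R : 'I_n -> rep Q k d, class_system R.
Proof.
rewrite card_eq_sym => /card_set_bijP [f [f_fun f_inj f_surj]].
have H (j : 'I_n) : exists M : rep Q k d, absolutely_indecomposable M /\ isoclass M = f j.
  by have [M aiM EM] := f_fun j (ltn_ord j); exists M.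
exists (fun j => sval (cid (H j))); split=> [j|M aiM|j j'].
- by case: (svalP (cid (H j))).
- have [j jn Ej] := f_surj (isoclass M) (ex_intro2 _ _ M aiM erefl).
  exists (Ordinal jn); apply/isoclass_eq; rewrite -Ej.
  by case: (svalP (cid (H (Ordinal jn)))).
- move/isoclass_eq; case: (svalP (cid (H j))) => _ ->.
  case: (svalP (cid (H j'))) => _ -> E; apply/val_inj.
  by apply: f_inj E; rewrite inE /= ltn_ord.
Qed.

(** The other orbits of a permutation of order [l] have [l] elements. *)
Lemma card_fixed_mod (T : finType) l (phi : T -> T) : prime l ->
  (forall x, iter l phi x = x) -> #|T| = #|[pred x | phi x == x]| %[mod l].
Proof.
move=> pr_l phil.
have inj_phi : injective phi.
  move=> x y E; rewrite -(phil x) -(phil y).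
  by case: (l) (prime_gt0 pr_l) => // m _; rewrite !iterSr E.
pose s := perm inj_phi.
have sE x : s x = phi x by rewrite permE.
have sX m x : (s ^+ m)%g x = iter m phi x by rewrite permX; apply: eq_iter.
have gs : (l.-group <[s]>)%g.
  rewrite /pgroup; apply: (@pnat_dvd _ l); last by rewrite pnat_id.
  by rewrite order_dvdn; apply/eqP/permP => x; rewrite sX phil perm1.
have := @pgroup_fix_mod _ _ _ ('P)%act l <[s]>%G [set: T]%SET gs.
rewrite cardsT => -> //; last by apply/actsP => a _ x; rewrite !inE.
congr (_ %% l)%N; apply: eq_card => x; rewrite finset.in_setI finset.in_setT [RHS]inE /=.
apply/afixP/eqP => [/(_ s (cycle_id s))|E a /cycleP [m ->]].
  by rewrite /= /aperm sE.
by rewrite /= /aperm sX; elim: m => //= m ->.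
Qed.

Section GradableStep.
Variables (V : finType) (A : Type) (Q : quiver V A) (F : finFieldType).
Variables (d : V -> nat) (l : nat) (zeta : F) (n : nat) (R : 'I_n -> rep Q F d).
Hypotheses (pr_l : prime l) (zeta_prim : l.-primitive_root zeta)
  (dl : forall i, (d i < l)%N) (sysR : class_system R).

Definition gradable_classes (G : groupType) (g : A -> G) :=
  [set j | `[< gradable g (R j) >]]%SET.

Section CentralExtension.
Variables (G Gb : groupType) (g : A -> G) (p : G -> Gb) (chi : G -> F).
Hypotheses (pM : {morph p : x y / (x * y)%g >-> (x * y)%g})
  (p_surj : forall y, exists x, p x = y)
  (kerC : forall x y : G, p x = 1%g -> (x * y = y * x)%g)
  (chi1 : chi 1%g = 1)
  (chiM : forall x y, p x = 1%g -> p y = 1%g -> chi (x * y)%g = chi x * chi y)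
  (chi_inj : forall x, p x = 1%g -> chi x = 1 -> x = 1%g)
  (chi_order : forall x, p x = 1%g -> chi x ^+ l = 1)
  (chi_surj : forall u, u ^+ l = 1 -> exists2 x, p x = 1%g & chi x = u)
  (noD : forall D : (forall i, 'I_(d i) -> Gb), unshiftable D).

Let twisted (M : rep Q F d) D m := twist g (fun x => chi x ^+ m) M D.

(** Twisting as a relation between classes: a choice of grading is involved. *)
Definition twist_rel j j' := exists (N : rep Q F d) (D : forall i, 'I_(d i) -> G),
  [/\ rep_iso (R j) N, graded (p \o g) N (fun i r => p (D i r)) &
    rep_iso (R j') (twist g chi N D)].

Lemma twist_rel_functional j j' k' : twist_rel j j' -> twist_rel j k' -> j' = k'.
Proof.
move=> [N [D [jN ND j'N]]] [N' [D' [jN' ND' k'N']]]; have [aiR _ uniqR] := sysR.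
apply: uniqR; apply: rep_iso_trans j'N _; apply: rep_iso_trans (rep_iso_sym k'N').
have NN' : rep_iso N N' by apply: rep_iso_trans (rep_iso_sym jN) jN'.
apply: (twist_iso pM p_surj kerC chi1 chiM) => //.
exact/absolutely_indecomposableW/(absolutely_indecomposable_iso jN).
Qed.

Lemma twist_rel_total j (N : rep Q F d) (D : forall i, 'I_(d i) -> G) : rep_iso (R j) N ->
  graded (p \o g) N (fun i r => p (D i r)) -> exists j', rep_iso (R j') (twist g chi N D).
Proof.
move=> jN ND; have [aiR surjR _] := sysR; apply: surjR.
apply: (twist_absolutely_indecomposable pM kerC chi1 chiM ND) => //.
exact: absolutely_indecomposable_iso jN (aiR j).
Qed.

(** Twisting by a character of order [l] permutes the classes that are graded
    by the quotient, and its fixed points are those graded by the extension. *)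
Lemma gradable_central_extension :
  #|gradable_classes (p \o g)| = #|gradable_classes g| %[mod l].
Proof.
have [aiR surjR uniqR] := sysR.
pose phi j := if pselect (exists j', twist_rel j j') is left h then sval (cid h) else j.
have phiE j j' : twist_rel j j' -> phi j = j'.
  rewrite /phi => h; case: pselect => [h'|[]]; last by exists j'.
  exact: twist_rel_functional (svalP (cid h')) h.
have gradP j : gradable (p \o g) (R j) <-> exists (N : rep Q F d) (D : forall i, 'I_(d i) -> G),
    rep_iso (R j) N /\ graded (p \o g) N (fun i r => p (D i r)).
  split=> [[N [Db [jN ND]]]|[N [D [jN ND]]]]; last by exists N, (fun i r => p (D i r)).
  exists N, (fun i r => sval (cid (p_surj (Db i r)))); split=> //.
  move=> a r c /ND E; have pK y : p (sval (cid (p_surj y))) = y := svalP (cid (p_surj y)).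
  by rewrite !pK.
have phiF j : ~ gradable (p \o g) (R j) -> phi j = j.
  rewrite /phi; case: pselect => // -[j' [N [D [jN ND _]]]] []; apply/gradP.
  by exists N, D.
have phil j : iter l phi j = j.
  have [/gradP [N [D [jN ND]]]|ng] := pselect (gradable (p \o g) (R j)); last first.
    by elim: (l) => //= m ->; apply: phiF.
  have chimM m x y : p x = 1%g -> p y = 1%g -> chi (x * y)%g ^+ m = chi x ^+ m * chi y ^+ m.
    by move=> px py; rewrite chiM // exprMn.
  have tw0 : twisted N D 0 = N.
    by apply: functional_extensionality_dep => a; apply/matrixP=> r c; rewrite mxE mul1r.
  have twS m : twist g chi (twisted N D m) D = twisted N D m.+1.
    apply: functional_extensionality_dep => a; apply/matrixP=> r c.
    by rewrite !mxE mulrA /cocycle exprS.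
  have twl : twisted N D l = N.
    apply: functional_extensionality_dep => a; apply/matrixP=> r c; rewrite mxE.
    have [->|/ND nM] := eqVneq (N a r c) 0; first by rewrite mulr0.
    by rewrite /cocycle chi_order ?mul1r // (projection_div pM) // pM nM.
  have twI m : rep_iso (R (iter m phi j)) (twisted N D m).
    elim: m => [|m IH]; first by rewrite tw0.
    have [j' Ej'] := twist_rel_total IH (twist_graded ND).
    rewrite iterS (phiE _ j'); first by rewrite -twS.
    by exists (twisted N D m), D; split=> //; apply: twist_graded.
  apply: uniqR; apply: rep_iso_trans (twI l) _; rewrite twl; exact: rep_iso_sym.
have fixE j : (phi j == j) =
    (j \in gradable_classes g) || (j \notin gradable_classes (p \o g)).
  rewrite !inE; apply/eqP/idP => [E|/orP[/asboolP|/asboolPn]].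
  - apply/orP; have [gr|/asboolPn ->] := pselect (gradable (p \o g) (R j)); last by right.
    left; apply/asboolP; have [N [D [jN ND]]] := (gradP j).1 gr.
    have [j' Ej'] := twist_rel_total jN ND.
    have Ejj : j = j' by rewrite -E; apply: phiE; exists N, D.
    rewrite -{}Ejj in Ej'; apply: (gradable_iso jN).
    apply: (twist_fixed_gradable pM p_surj kerC chi1 chiM chi_inj chi_order chi_surj
      pr_l zeta_prim dl ND) => //.
      exact: absolutely_indecomposable_iso jN (aiR j).
    exact: rep_iso_trans (rep_iso_sym jN) Ej'.
  - move=> [N [D [jN ND]]]; apply: phiE; exists N, D; split=> //.
      by move=> a r c /ND ->; rewrite pM.
    by rewrite (twist_id chi1 ND).
  - exact: phiF.
have sub : gradable_classes g \subset gradable_classes (p \o g).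
  apply/fintype.subsetP => j; rewrite !inE => -[N [D [jN ND]]].
  exists N, (fun i r => p (D i r)); split; first exact: jN.
  by move=> a r c /ND ->; rewrite pM.
have := card_fixed_mod pr_l phil; rewrite card_ord.
have -> : #|[pred x | phi x == x]| = (#|gradable_classes g| + #|~: gradable_classes (p \o g)|)%N.
  rewrite -cardsUI (_ : _ :&: _ = finset.set0)%SET ?cards0 ?addn0.
    by apply: eq_card => j; rewrite inE fixE finset.in_setU finset.in_setC.
  apply/eqP; rewrite -finset.subset0; apply/fintype.subsetP => j.
  by rewrite finset.in_setI finset.in_setC => /andP[/(fintype.subsetP sub) ->].
have En : (#|gradable_classes (p \o g)| + #|~: gradable_classes (p \o g)| = n)%N.
  by rewrite cardsC card_ord.
by rewrite -{1}En => /eqP; rewrite eqn_modDr => /eqP.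
Qed.

End CentralExtension.
End GradableStep.

(** A nontrivial element of an [l]-group has order at least [l]. *)
Lemma unshiftable_lgroup (V : finType) (d : V -> nat) l (gT : finGroupType) i0 :
  prime l -> (forall i, (d i < l)%N) -> (0 < d i0)%N -> (l.-group [set: gT])%g ->
  forall D : (forall i, 'I_(d i) -> gT), unshiftable D.
Proof.
move=> pr_l dl d0 lG D; apply: (unshiftable_torsion d0) => h m /andP[m0 md] hm.
have lh : (l.-elt h)%g by apply: mem_p_elt lG _; rewrite finset.in_setT.
have hdvd : (#[h]%g %| m)%N by rewrite order_dvdn hm.
apply/eqP; rewrite -order_eq1; case: (p_natP lh) => -[|e] E; first by rewrite E.
have : (l <= m)%N.
  by rewrite dvdn_leq // (dvdn_trans _ hdvd) // E expnS dvdn_mulr.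
by rewrite leqNgt (leq_ltn_trans md (dl i0)).
Qed.

Section CyclicCharacter.
Variables (F : fieldType) (l : nat) (zeta : F) (gT : finGroupType) (x : gT).
Hypotheses (zeta_prim : l.-primitive_root zeta) (ox : #[x]%g = l).

Definition cyclic_character (y : gT) : F :=
  if [pick i : 'I_l | (x ^+ i)%g == y] is Some i then zeta ^+ i else 0.

Lemma cyclic_characterE i : cyclic_character (x ^+ i)%g = zeta ^+ i.
Proof.
rewrite /cyclic_character; case: pickP => [j|/(_ (Ordinal (ltn_pmod i (prim_order_gt0 zeta_prim))))].
  rewrite eq_expg_mod_order ox => /eqP E; apply/eqP.
  by rewrite (eq_prim_root_expr zeta_prim) E.
by rewrite eq_expg_mod_order ox /= modn_mod eqxx.
Qed.

End CyclicCharacter.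

Section LGroups.
Variables (V : finType) (A : Type) (Q : quiver V A) (F : finFieldType).
Variables (d : V -> nat) (l : nat) (zeta : F) (n : nat) (R : 'I_n -> rep Q F d).
Variable i0 : V.
Hypotheses (pr_l : prime l) (zeta_prim : l.-primitive_root zeta)
  (dl : forall i, (d i < l)%N) (d0 : (0 < d i0)%N) (sysR : class_system R).

(** A nontrivial [l]-group has a central subgroup of order [l]: induction passes
    to the quotient, down to the trivial group, which grades everything. *)
Lemma lgroup_gradable_classes (gT : finGroupType) (g : A -> gT) :
  (l.-group [set: gT])%g -> #|gradable_classes R g| = n %[mod l].
Proof.
have [m] := ubnP #|gT|; elim: m gT g => // m IH gT g; rewrite ltnS => cardG lG.
have [G1|ntG] := eqVneq ([set: gT]%G : {set gT}) 1%g.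
  congr (_ %% l)%N; rewrite -[RHS](card_ord n); apply: eq_card => j; rewrite !inE.
  apply/asboolP; exists (R j), (fun _ _ => 1%g); split; first exact: rep_iso_refl.
  move=> a r c _; rewrite mul1g; apply/esym/eqP; rewrite -finset.in_set1.
  by move: (finset.in_setT (g a)); rewrite G1.
have ntZ : ('Z([set: gT]) != 1)%g.
  by rewrite center_nil_eq1 ?(pgroup_nil lG).
have lZ : (l %| #|'Z([set: gT])%g|)%N.
  by have [] := pgroup_pdiv (pgroupS (center_sub [set: gT]%G) lG) ntZ.
have [x xZ ox] := Cauchy pr_l lZ.
have cx y : commute x y.
  by case/centerP: xZ => _; apply; rewrite finset.in_setT.
pose Z := <[x]>%G.
have nZ y : y \in 'N(Z)%g.
  by apply: (fintype.subsetP (cent_sub _)); rewrite cent_cycle; apply/cent1P/esym/cx.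
have pM : {morph coset Z : x y / (x * y)%g >-> (x * y)%g} by move=> u v; apply: morphM.
have kerZ y : coset Z y = 1%g -> exists i, y = (x ^+ i)%g.
  move=> E; apply/cycleP; have : y \in ('ker (coset Z))%g by apply/kerP.
  by rewrite ker_coset.
have cosetX i : coset Z (x ^+ i)%g = 1%g by apply/coset_id/mem_cycle.
pose chi := cyclic_character l zeta x.
have chiE i : chi (x ^+ i)%g = zeta ^+ i := cyclic_characterE zeta_prim ox i.
have ltZ : (#|{: coset_of Z}| < m)%N.
  apply: leq_trans cardG; rewrite -[X in (X < _)%N]cardsT -quotientT -[X in (_ < X)%N]cardsT.
  apply: ltn_quotient (finset.subsetT _).
  by rewrite /Z /= cycle_eq1 -order_eq1 ox gtn_eqF // prime_gt1.
have lGb : (l.-group [set: coset_of Z])%g.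
  by rewrite -quotientT; apply: quotient_pgroup.
rewrite -(IH (coset_of Z) (coset Z \o g)) //.
apply/esym; apply: (@gradable_central_extension V A Q F d l zeta n R pr_l zeta_prim dl sysR
  gT (coset_of Z) g (coset Z) chi pM).
- move=> y; exists (repr y); exact: coset_reprK.
- by move=> u v /kerZ [i ->]; exact/commute_sym/commuteX/commute_sym/cx.
- by rewrite -(expg0 x) chiE.
- by move=> u v /kerZ [i ->] /kerZ [j ->]; rewrite -expgD !chiE exprD.
- move=> u /kerZ [i ->]; rewrite chiE => /eqP.
  rewrite -(prim_order_dvd zeta_prim) -ox => /dvdnP [k ->].
  by rewrite mulnC expgM expg_order expg1n.
- by move=> u /kerZ [i ->]; rewrite chiE -exprM mulnC exprM (prim_expr_order zeta_prim) expr1n.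
- by move=> u /(prim_rootP zeta_prim) [i ->]; exists (x ^+ i)%g.
- exact: unshiftable_lgroup pr_l dl d0 lGb.
Qed.

End LGroups.

(** * Free groups are residually [l]-groups *)

Section WordEvaluation.
Variables (A : choiceType) (G : groupType) (g : A -> G).

Definition letter_value (x : A * bool) : G := if x.2 then (g x.1)^-1%g else g x.1.

Definition word_value (w : seq (A * bool)) : G :=
  foldr (fun x y => (letter_value x * y)%g) 1%g w.

Lemma letter_value_linv x : letter_value (linv x) = (letter_value x)^-1%g.
Proof. by case: x => a [] /=; rewrite /letter_value /= ?invgK. Qed.

Lemma word_value_wcons x w : word_value (wcons x w) = (letter_value x * word_value w)%g.
Proof.
case: w => [|y w] //=; case: eqP => [->|//].
by rewrite letter_value_linv mulgA mulgV mul1g.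
Qed.

Lemma word_valueM (u v : freegroup A) :
  word_value (u * v)%g = (word_value u * word_value v)%g.
Proof.
rewrite -[fgword (u * v)%g]/(wmul u v); elim: (fgword u) => [|x w IH] /=.
  by rewrite mul1g.
by rewrite word_value_wcons IH mulgA.
Qed.

Lemma word_value_gen a : word_value (fggen a) = g a.
Proof. by rewrite /= mulg1. Qed.

Lemma word_value1 : word_value (1%g : freegroup A) = 1%g.
Proof. by []. Qed.

Lemma word_valueV (u : freegroup A) : word_value u^-1%g = (word_value u)^-1%g.
Proof.
apply: (mulgI (word_value u)); rewrite -word_valueM mulgV mulgV.
exact: word_value1.
Qed.

End WordEvaluation.

Lemma size_fgmul (A : choiceType) (u v : freegroup A) :
  (size (u * v)%g <= size u + size v)%N.
Proof.
rewrite -[fgword (u * v)%g]/(wmul u v); elim: (fgword u) => [|x w IH] //=.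
apply: leq_trans (_ : (size (wmul w v)).+1 <= _)%N; last by rewrite addSn ltnS.
case: (wmul w v) => [|y s] //=; case: ifP => // _.
by rewrite (leq_trans _ (leqnSn _)).
Qed.

Lemma size_fginv (A : choiceType) (u : freegroup A) : size u^-1%g = size u.
Proof. by rewrite -[fgword u^-1%g]/(winv u) /winv size_rev size_map. Qed.

(** A letter [a] acts on vectors with coefficients indexed by the prefixes of a
    sequence [sg], as [1 + X] where [X] extends a prefix by the letter [a] if
    that is the next letter of [sg], and kills it otherwise. Prefixes that
    already end with [a] are killed in any case: so [X ^ 2 = 0], the inverse of
    [1 + X] is [1 - X], and the powers of [a] act by [1 + m X]. *)
Section Transvections.
Variables (F : fieldType) (A : choiceType).
Implicit Types (sg : seq A) (x : A * bool) (f : nat -> F).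

Definition active sg a j := [&& (0 < j)%N, onth sg j.-1 == Some a &
  (j == 1%N) || (onth sg j.-2 != Some a)].

Definition transvect sg x f j : F :=
  f j + (if active sg x.1 j then (-1) ^+ x.2 * f j.-1 else 0).

Lemma active_pred sg a j : active sg a j -> ~~ active sg a j.-1.
Proof.
case: j => [|[|j]] //= /and3P[_ _ /= ne]; apply/negP => /and3P[_ /= E _].
by rewrite E in ne.
Qed.

Lemma transvectK sg a b f j :
  transvect sg (a, ~~ b) (transvect sg (a, b) f) j = f j.
Proof.
rewrite /transvect /=; case act: (active sg a j); last by rewrite !addr0.
rewrite (negPf (active_pred act)) addr0 -addrA -mulrDl.
by case: b; rewrite /= ?expr0 ?expr1 ?subrr ?addNr mul0r addr0.
Qed.

Fixpoint syllables a (w : seq (A * bool)) : seq A :=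
  if w is x :: w' then if x.1 == a then syllables a w' else x.1 :: syllables x.1 w'
  else [::].

Lemma size_syllables a w : (size (syllables a w) <= size w)%N.
Proof.
elim: w a => //= x w IH a; case: ifP => _; last by rewrite ltnS.
exact: leq_trans (IH _) (leqnSn _).
Qed.

(** In a reduced word each syllable [a ^ m] multiplies the leading coefficient by
    the exponent [m], up to sign; exponents smaller than the characteristic are
    nonzero. In the induction, [t] letters of [sg] are already reached, and the
    current syllable, of letter [a], has length [m] so far. *)
Lemma transvect_syllables sg w a b t m f : path (fun x y => y != linv x) (a, b) w ->
  (0 < t)%N -> onth sg t.-1 = Some a -> (t == 1%N) || (onth sg t.-2 != Some a) ->
  drop t sg = syllables a w -> (forall k, (0 < k <= m + size w)%N -> k%:R != 0 :> F) ->
  (0 < m)%N -> f t.-1 != 0 -> f t = (-1) ^+ b * m%:R * f t.-1 ->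
  (forall j, (t < j)%N -> f j = 0) ->
  foldl (fun h x => transvect sg x h) f w (size sg) != 0.
Proof.
elim: w a b t m f => [|[c e] w IH] a b t m f /= red t0 st stp dr hk m0 fp ft fz;
  have ts : (t <= size sg)%N by case: (ltnP t.-1 (size sg)); rewrite ?prednK // => /onth_default; rewrite st.
  have -> : size sg = t.
    apply/eqP; rewrite eqn_leq ts andbT.
    by rewrite -subn_eq0 -size_drop dr.
  rewrite ft mulf_neq0 // mulf_neq0 ?signr_eq0 //.
  by rewrite hk // m0 addn0 leqnn.
case/andP: red => ne red; case: eqVneq dr => [ca|ca] dr.
- rewrite {}ca in ne red dr *.
  have eb : e = b by move: ne; rewrite /linv /= xpair_eqE eqxx /=; case: (e) (b) => [] [].
  have actt : active sg a t by rewrite /active t0 st eqxx.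
  apply: (IH a e t m.+1) => //.
  + by move=> k; rewrite addSnnS; apply: hk.
  + by rewrite /transvect /= (negPf (active_pred actt)) addr0.
  + rewrite /transvect /= actt (negPf (active_pred actt)) addr0 ft eb.
    by rewrite -mulrDl -[m.+1]addn1 natrD mulrDr mulr1.
  + move=> j tj; rewrite /transvect fz // add0r; case: ifP => //.
    case/and3P => _ _; case: j tj => [|[|j]] //; first by rewrite ltnS leqn0 gtn_eqF.
    rewrite /= ltnS leq_eqVlt => /orP[/eqP Et|tj _]; first by rewrite (_ : j = t.-1) ?st ?eqxx // Et.
    by rewrite fz ?mulr0.
- have st1 : onth sg t = Some c.
    by rewrite -(cat_take_drop t sg) dr onth_cat size_takel // ltnn subnn.
  have actt : active sg c t.+1.
    by rewrite /active /= st1 eqxx st /=; apply/orP; right; apply: contra ca => /eqP[->].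
  have nact : active sg c t = false.
    by apply/negP => /and3P[_]; rewrite st => /eqP[E]; rewrite E eqxx in ca.
  have ftt : transvect sg (c, e) f t = f t by rewrite /transvect /= nact addr0.
  apply: (IH c e t.+1 1%N) => //=.
  + by rewrite st; apply/orP; right; apply: contra ca => /eqP[->].
  + by rewrite -addn1 addnC -drop_drop dr /= drop0.
  + move=> k /andP[k0 kw]; apply: hk; rewrite k0 (leq_trans kw) //.
    by rewrite -addSnnS leq_add2r.
  + rewrite ftt ft mulf_neq0 // mulf_neq0 ?signr_eq0 // hk // m0.
    by rewrite leq_addr.
  + by rewrite ftt /transvect /= actt fz // add0r mulr1.
  + move=> j tj; rewrite /transvect fz ?add0r; last exact: ltnW.
    by case: ifP => // _; rewrite fz ?mulr0 // -ltnS; case: (j) tj.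
Qed.

End Transvections.

Section TriangularGroup.
Variables (A : finType) (l L : nat).
Hypothesis pr_l : prime l.
Local Notation F := 'F_l.
Local Notation index := (L.-bseq A * 'I_L.+1)%type.
Local Notation vec := {ffun index -> F}.
Implicit Types (v : vec) (sg : L.-bseq A).

Definition coef v sg (j : nat) : F := oapp (fun k => v (sg, k)) 0 (insub j).

Lemma coef_ord v sg (k : 'I_L.+1) : coef v sg k = v (sg, k).
Proof. by rewrite /coef valK. Qed.

Definition transvection x v : vec := [ffun p : index => transvect p.1 x (coef v p.1) p.2].

Lemma coef_transvection x v sg : coef (transvection x v) sg = transvect sg x (coef v sg).
Proof.
apply: funext => j; have [jL|jL] := ltnP j L.+1.
  by rewrite -[j]/(val (Ordinal jL)) coef_ord ffunE.
rewrite /transvect /coef insubN -?leqNgt //= add0r; case: ifP => //.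
case/and3P => _; rewrite onth_default // (leq_trans (size_bseq sg)) //.
by rewrite -ltnS prednK // (leq_trans _ jL).
Qed.

Lemma transvectionK a b : cancel (transvection (a, b)) (transvection (a, ~~ b)).
Proof.
move=> v; apply/ffunP => -[sg k]; rewrite ffunE /= coef_transvection.
by rewrite transvectK coef_ord.
Qed.

Definition transvection_perm a := perm (can_inj (@transvectionK a false)).

Lemma transvection_permV a v : (transvection_perm a)^-1%g v = transvection (a, true) v.
Proof.
apply: (@perm_inj _ (transvection_perm a)); rewrite permKV permE.
by rewrite (@transvectionK a true).
Qed.

Definition agree_below (k : nat) v v' := forall sg (i : 'I_L.+1), (i < k)%N ->
  v (sg, i) = v' (sg, i).

(** Permutations changing each coefficient by an amount that only depends on
    the coefficients of lower index. *)
Definition triangular (s : {perm vec}) := forall (k : 'I_L.+1) v v',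
  agree_below k v v' ->
  forall sg, s v (sg, k) - v (sg, k) = s v' (sg, k) - v' (sg, k).

Definition triangular_set := [set s : {perm vec} | `[< triangular s >]]%SET.

Lemma triangular_agree s k v v' : triangular s -> agree_below k v v' ->
  agree_below k (s v) (s v').
Proof.
move=> ts vv' sg i ik; apply: (addIr (- v (sg, i))).
rewrite {2}(vv' sg i ik); apply: ts => sg' j ji.
exact/vv'/(ltn_trans ji).
Qed.

Lemma triangular_mul s t : triangular s -> triangular t -> triangular (s * t)%g.
Proof.
move=> ts tt k v v' vv' sg; rewrite !permM.
have split_diff (x y z : F) : x - z = (x - y) + (y - z) by rewrite addrA subrK.
rewrite (split_diff _ (s v (sg, k))) [RHS](split_diff _ (s v' (sg, k))).
by rewrite (tt k _ _ (triangular_agree ts vv')) (ts k _ _ vv').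
Qed.

Lemma triangular_group_set : group_set triangular_set.
Proof.
apply/group_setP; split=> [|s t].
  by rewrite finset.inE; apply/asboolP => k v v' vv' sg; rewrite !perm1 !subrr.
rewrite !finset.inE => /asboolP ts /asboolP tt; apply/asboolP.
exact: triangular_mul.
Qed.

Canonical triangular_group := Group triangular_group_set.

Lemma triangularP s : s \in triangular_set -> triangular s.
Proof. by rewrite finset.inE => /asboolP. Qed.

(** If [s] fixes the coefficients below [k] then it translates coefficient [k]
    by a constant, of order dividing [l]. *)
Lemma triangular_exp s k : triangular s ->
  forall v, agree_below k ((s ^+ (l ^ k))%g v) v.
Proof.
move=> ts; elim: k => // k IH v sg i; rewrite ltnS leq_eqVlt.
set r := (s ^+ (l ^ k))%g; have tr : triangular r.
  apply: triangularP; rewrite (@groupX _ triangular_group) // finset.inE.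
  exact/asboolP.
have agr m u : agree_below k ((r ^+ m)%g u) u.
  elim: m => [|m IHm] sg' j jk; first by rewrite expg0 perm1.
  by rewrite expgSr permM IH // IHm.
rewrite expnSr expgM -/r; case/orP => [/eqP ik|ik]; last exact: agr.
have E m u : (r ^+ m)%g u (sg, i) = u (sg, i) + (r u (sg, i) - u (sg, i)) *+ m.
  elim: m => [|m IHm]; first by rewrite expg0 perm1 addr0.
  rewrite expgSr permM -(subrK ((r ^+ m)%g u (sg, i)) (r _ _)).
  rewrite (tr i ((r ^+ m)%g u) u); last by rewrite ik; apply: agr.
  by rewrite IHm addrCA -mulrS.
by rewrite E mulrn_pchar ?pchar_Fp // addr0.
Qed.

Lemma triangular_lgroup : (l.-group triangular_set)%g.
Proof.
apply/pgroupP => q pr_q /(Cauchy pr_q) [s /triangularP ts os].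
rewrite inE; have : (#[s]%g %| l ^ L.+1)%N.
  rewrite order_dvdn; apply/eqP/permP => v; rewrite perm1; apply/ffunP => -[sg k].
  exact: triangular_exp.
by rewrite os Euclid_dvdX // dvdn_prime2 // => /andP[].
Qed.

Lemma transvection_triangular a : transvection_perm a \in triangular_set.
Proof.
rewrite finset.inE; apply/asboolP => k v v' vv' sg.
rewrite !permE !ffunE /transvect /= !coef_ord addrC addKr addrC addKr.
case: ifP => // /andP[k0 _]; congr (_ * _).
have kL : (k.-1 < L.+1)%N by rewrite (leq_ltn_trans (leq_pred _)).
by rewrite -[k.-1]/(val (Ordinal kL)) !coef_ord; apply: vv'; rewrite /= prednK.
Qed.

(** Letters act on the vectors for all sequences [sg] at the same time, so that a
    single group detects every short word. *)
Definition transvection_sub a : subg_of triangular_group :=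
  subg triangular_group (transvection_perm a).

Lemma word_value_transvection (w : seq (A * bool)) v :
  sgval (word_value transvection_sub w) v = foldl (fun u x => transvection x u) v w.
Proof.
elim: w v => [|[a b] w IH] v; first by rewrite /= perm1.
rewrite [word_value _ _]/= [sgval _]/= permM IH /=; congr foldl.
have sgvalE : sgval (transvection_sub a) = transvection_perm a.
  by rewrite /transvection_sub subgK // transvection_triangular.
case: b; rewrite /letter_value /=; last by rewrite sgvalE permE.
by rewrite sgvalE transvection_permV.
Qed.

(** The word moves the vector of the empty prefix, as seen on the coefficient of
    its own sequence of syllables. *)
Lemma word_value_neq1 (w : freegroup A) : (L < l)%N -> (size w <= L)%N ->
  w <> 1%g -> word_value transvection_sub w <> 1%g.
Proof.
move=> Ll wL w1 E; pose v0 : vec := [ffun p : index => (p.2 == 0%N :> nat)%:R].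
case: w => -[|[a b] w] red /= in wL w1 E.
  by apply: w1; apply: val_inj.
pose sg0 := a :: syllables a w.
have sgL : (size sg0 <= L)%N by apply: leq_ltn_trans (size_syllables _ _) wL.
pose sg : L.-bseq A := Bseq sgL.
have := word_value_transvection ((a, b) :: w) v0.
rewrite [word_value _ _]E [LHS](_ : _ = v0); last by rewrite /= perm1.
move/(congr1 (fun u => coef u sg (size sg0))).
have foldE u s : coef (foldl (fun u x => transvection x u) u s) sg =
    foldl (fun h x => transvect sg x h) (coef u sg) s.
  by elim: s u => //= x s IH u; rewrite IH coef_transvection.
have sgE : (size sg0 < L.+1)%N by [].
rewrite foldE -{1}[size sg0]/(val (Ordinal sgE)) coef_ord ffunE /=.
apply/eqP; rewrite eq_sym; have c0 : coef v0 sg 0 = 1.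
  by rewrite (coef_ord v0 sg ord0) ffunE.
have cS j : coef v0 sg j.+1 = 0.
  by rewrite /coef; case: insubP => //= k _ kj; rewrite ffunE /= kj.
have act : active sg a 1 by rewrite /active /= eqxx.
apply: (@transvect_syllables _ _ sg0 w a b 1 1) => //=.
- by rewrite drop0.
- move=> k /andP[k0 kw]; rewrite -(dvdn_pcharf (pchar_Fp pr_l)) gtnNdvd //.
  by rewrite (leq_ltn_trans kw) // (leq_ltn_trans wL).
- by rewrite /transvect /= c0 addr0 oner_neq0.
- by rewrite /transvect /= act c0 cS add0r addr0 !mulr1.
- move=> [|[|j]] // _; rewrite /transvect cS /= add0r; case: ifP => // _.
  by rewrite cS mulr0.
Qed.

End TriangularGroup.

Lemma free_group_residually_lgroup (A : finType) l L : prime l -> (L < l)%N ->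
  exists (gT : finGroupType) (g : A -> gT), (l.-group [set: gT])%g /\
    forall w : freegroup A, (size w <= L)%N -> w <> 1%g -> word_value g w <> 1%g.
Proof.
move=> pr_l Ll.
exists (subg_of (triangular_group A l L)), (@transvection_sub A l L); split.
  have := triangular_lgroup A L pr_l.
  rewrite /pgroup (card_isog (isog_subg (triangular_group A l L))).
  by congr (pnat _ #|_|); apply/setP => x; rewrite finset.inE.
by move=> w; apply: word_value_neq1.
Qed.

(** In an [l]-group, an element of order dividing [n < l] is trivial. *)
Lemma freegroup_torsion_free (A : finType) (w : freegroup A) n :
  (0 < n)%N -> (w ^+ n = 1)%g -> w = 1%g.
Proof.
move=> n0 wn; apply: contrapT => w1.
have [l ll pr_l] := prime_above (maxn (size w) n).
have [gT [g [lG gP]]] := @free_group_residually_lgroup A l (size w) pr_l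
  (leq_ltn_trans (leq_maxl _ _) ll).
have vX m : word_value g (w ^+ m)%g = (word_value g w ^+ m)%g.
  by elim: m => // m IH; rewrite !expgS word_valueM IH.
apply: (gP w) => //; set h := word_value g w.
have hn : (h ^+ n = 1)%g by rewrite -vX wn.
have lh : (l.-elt h)%g by apply: mem_p_elt lG _; rewrite finset.in_setT.
have hdvd : (#[h]%g %| n)%N by rewrite order_dvdn hn.
apply/eqP; rewrite -order_eq1; case: (p_natP lh) => -[|e] E; first by rewrite E.
have : (l <= n)%N.
  by rewrite dvdn_leq // (dvdn_trans _ hdvd) // E expnS dvdn_mulr.
by rewrite leqNgt (leq_ltn_trans (leq_maxr _ _) ll).
Qed.

(** * The coefficient graph of a representation *)

Lemma word_value_self (A : choiceType) (w : freegroup A) :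
  word_value (@fggen A) w = w.
Proof.
suff H s (red : reduced s) : word_value (@fggen A) s = FreeGroup red.
  by case: w => s red; apply: H.
elim: s red => [|[a b] s IH] red; first exact: val_inj.
have red' : reduced s by apply: path_sorted red.
rewrite /= (IH red'); apply: val_inj.
transitivity (wcons (a, b) s); first by case: b {red}.
by case: s red {IH red'} => //= y s /andP[/negPf ->].
Qed.

Section CoefficientGraph.
Variables (V A : finType) (Q : quiver V A) (K : fieldType) (d : V -> nat).
Variable N : rep Q K d.
Local Notation basis := {i : V & 'I_(d i)}.
Local Notation deg D b := (D (tag b) (tagged b)).

Definition vec_at i (r : 'I_(d i)) : basis := Tagged (fun i => 'I_(d i)) r.

Definition arrow_rel (b b' : basis) := [exists a, exists r, exists c,
  [&& N a r c != 0, b == vec_at r & b' == vec_at c]].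

Definition edge_rel b b' := arrow_rel b b' || arrow_rel b' b.

Lemma arrow_relP b b' :
  reflect (exists a r c, [/\ N a r c != 0, b = vec_at r & b' = vec_at c]) (arrow_rel b b').
Proof.
apply: (iffP existsP) => [[a /existsP[r /existsP[c /and3P[nz /eqP-> /eqP->]]]]|].
  by exists a, r, c.
case=> a [r [c [nz -> ->]]]; exists a; apply/existsP; exists r; apply/existsP; exists c.
by rewrite nz !eqxx.
Qed.

Lemma edge_rel_sym : symmetric edge_rel.
Proof. by move=> b b'; rewrite /edge_rel orbC. Qed.

Lemma edge_connect_sym : connect_sym edge_rel.
Proof. exact/sym_connect_sym/edge_rel_sym. Qed.

Lemma arrow_root a r c : N a r c != 0 ->
  fingraph.root edge_rel (vec_at r) = fingraph.root edge_rel (vec_at c).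
Proof.
move=> nz; apply/eqP; rewrite (root_connect edge_connect_sym); apply: connect1.
by apply/orP; left; apply/arrow_relP; exists a, r, c.
Qed.

(** Along a path of the coefficient graph, the degree changes by the value of
    the word spelled by the arrows of the path, whatever the grading. *)
Lemma path_degree b p : path edge_rel b p -> exists2 u : freegroup A,
  (size u <= size p)%N &
  forall (G : groupType) (g : A -> G) (D : forall i, 'I_(d i) -> G), graded g N D ->
    deg D (last b p) = (deg D b * word_value g u)%g.
Proof.
elim: p b => [|b' p IH] b /=.
  by exists 1%g => // G g D _; rewrite word_value1 mulg1.
case/andP => E /IH [u su Hu].
have [x [sx Hx]] : exists x : freegroup A, size x = 1%N /\
    forall (G : groupType) (g : A -> G) (D : forall i, 'I_(d i) -> G), graded g N D ->
    deg D b' = (deg D b * word_value g x)%g.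
  case/orP: E => /arrow_relP [a [r [c [nz -> ->]]]].
    by exists (fggen a); split=> // G g D ND; rewrite word_value_gen; apply: ND.
  exists (fggen a)^-1%g; split; first by rewrite size_fginv.
  by move=> G g D ND; rewrite word_valueV word_value_gen /= (ND _ _ _ nz) mulgK.
exists (x * u)%g; first by rewrite (leq_trans (size_fgmul _ _)) // sx ltnS.
by move=> G g D ND; rewrite (Hu _ _ _ ND) (Hx _ _ _ ND) word_valueM mulgA.
Qed.

Lemma connect_degree b b' : connect edge_rel b b' -> exists2 u : freegroup A,
  (size u <= #|{: basis}|)%N &
  forall (G : groupType) (g : A -> G) (D : forall i, 'I_(d i) -> G), graded g N D ->
    deg D b' = (deg D b * word_value g u)%g.
Proof.
case/connectP => p0 /shortenP [p ep up _] ->.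
have [u su Hu] := path_degree ep; exists u => //; apply: leq_trans su _.
have : (size (b :: p) <= #|{: basis}|)%N by rewrite -(card_uniqP up) max_card.
exact: ltnW.
Qed.

(** Closed walks have bounded length, so a grading by a group in which short
    words are nontrivial lifts to the free group. *)
Lemma graded_lift (gT : groupType) (g : A -> gT) (D : forall i, 'I_(d i) -> gT) :
  (forall w : freegroup A, (size w <= (#|{: basis}| + #|{: basis}|).+1)%N ->
     w <> 1%g -> word_value g w <> 1%g) ->
  graded g N D ->
  exists D' : (forall i, 'I_(d i) -> freegroup A), graded (@fggen A) N D'.
Proof.
move=> inj ND.
have H b : connect edge_rel (fingraph.root edge_rel b) b.
  by rewrite edge_connect_sym connect_root.
pose x b := s2val (cid2 (connect_degree (H b))).
have su b : (size (x b) <= #|{: basis}|)%N := s2valP (cid2 (connect_degree (H b))).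
have Hx b : deg D b = (deg D (fingraph.root edge_rel b) * word_value g (x b))%g.
  exact: (s2valP' (cid2 (connect_degree (H b)))) ND.
exists (fun i r => x (vec_at r)) => a r c nz.
apply: contrapT => ne; set w := ((x (vec_at c))^-1 * (x (vec_at r) * fggen a))%g.
have w1 : w <> 1%g.
  move=> E; apply: ne; apply: (mulgI (x (vec_at c))^-1%g).
  by rewrite mulVg -/w E.
apply: (inj w) => //.
  apply: leq_trans (size_fgmul _ _) _; rewrite size_fginv -addnS leq_add //.
  by apply: leq_trans (size_fgmul _ _) _; rewrite addn1 ltnS.
rewrite !word_valueM word_valueV word_value_gen.
apply: (mulgI (word_value g (x (vec_at c)))); rewrite mulVKg mulg1.
apply: (mulgI (deg D (fingraph.root edge_rel (vec_at c)))).
have := ND _ _ _ nz; have := Hx (vec_at r); have := Hx (vec_at c).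
by rewrite (arrow_root nz) /= => <- Er ->; rewrite mulgA -Er.
Qed.

(** The projection onto the basis vectors of one component of the coefficient
    graph is an idempotent endomorphism. *)
Lemma trivial_idempotents_connected : trivial_idempotents N (fun=> True) ->
  forall b b' : basis, connect edge_rel b b'.
Proof.
move=> triv b b'; rewrite -(root_connect edge_connect_sym) eq_sym.
pose e i : 'M[K]_(d i) := diag_mx (\row_r (fingraph.root edge_rel (vec_at r) == fingraph.root edge_rel b)%:R).
have he : is_rep_hom N N e.
  move=> a; apply/matrixP => r c; rewrite mul_mx_diag mul_diag_mx !mxE.
  have [->|/arrow_root ->] := eqVneq (N a r c) 0; first by rewrite mulr0 mul0r.
  by rewrite mulrC.
have ee i : e i *m e i = e i.
  apply/matrixP => r c; rewrite mul_diag_mx !mxE.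
  by case: (fingraph.root _ _ == _); rewrite ?mul1r ?mul0r ?mul0rn.
have vecE b'' : vec_at (tagged b'') = b'' by case: b''.
case: (triv e I he ee) => [/(_ (tag b))/matrixP/(_ (tagged b) (tagged b))|].
  by rewrite !mxE eqxx mulr1n vecE eqxx => /eqP; rewrite oner_eq0.
move/(_ (tag b'))/matrixP/(_ (tagged b') (tagged b')).
rewrite !mxE eqxx !mulr1n vecE; case: eqP => // _ /esym/eqP.
by rewrite oner_eq0.
Qed.

Lemma graded_bounded (D : forall i, 'I_(d i) -> freegroup A) (b0 : basis) :
  trivial_idempotents N (fun=> True) -> graded (@fggen A) N D ->
  forall b : basis, exists2 u : freegroup A, (size u <= #|{: basis}|)%N &
    deg D b = (deg D b0 * u)%g.
Proof.
move=> triv ND b.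
have [u su Hu] := connect_degree (trivial_idempotents_connected triv b0 b).
by exists u => //; rewrite (Hu _ _ _ ND) word_value_self.
Qed.

End CoefficientGraph.

Lemma gradable_lift (V A : finType) (Q : quiver V A) (K : fieldType) (d : V -> nat)
    (M : rep Q K d) (gT : groupType) (g : A -> gT) :
  (forall w : freegroup A, (size w <= (#|{: {i : V & 'I_(d i)}}| +
       #|{: {i : V & 'I_(d i)}}|).+1)%N -> w <> 1%g -> word_value g w <> 1%g) ->
  gradable g M <-> gradable (@fggen A) M.
Proof.
move=> inj; split=> -[N [D [iMN ND]]]; exists N.
  by have [D' ND'] := graded_lift inj ND; exists D'.
exists (fun i r => word_value g (D i r)); split=> // a r c /ND ->.
by rewrite word_valueM word_value_gen.
Qed.

(** * Representations of the universal covering and graded representations *)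

Section Selection.
Variables (K : fieldType) (T : eqType).

(** Rows are indexed by ['I_m] and list the coordinates of degree [t] in order;
    matching through [index] spares casts between ['I_m] and a subtype. *)
Definition select n (D : 'I_n -> T) m (t : T) : 'M[K]_(m, n) :=
  \matrix_(s, r) ((D r == t) && (index r (enum [pred r | D r == t]) == s))%:R.

(** The row number [r] is taken from the matrix attached to its degree. *)
Definition rowwise n p (D : 'I_n -> T) (Z : T -> 'M[K]_(n, p)) : 'M[K]_(n, p) :=
  \matrix_(r, c) Z (D r) r c.

Variables (n : nat) (D : 'I_n -> T).

Lemma select_trK m t : m = #|[pred r | D r == t]| ->
  select D m t *m (select D m t)^T = 1%:M.
Proof.
move=> Em; apply/matrixP => s s'; rewrite !mxE.
have ss : (s < size (enum [pred r | D r == t]))%N by rewrite -cardE -Em.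
have [r0 _ _] : exists2 r0 : 'I_n, true & true by case: (enum _) ss => // r0; exists r0.
pose r := nth r0 (enum [pred r | D r == t]) s.
have Dr : D r == t by have := mem_nth r0 ss; rewrite mem_enum.
have ir : index r (enum [pred r | D r == t]) = s by rewrite index_uniq ?enum_uniq.
rewrite (bigD1 r) //= !mxE Dr ir eqxx /= mul1r big1 ?addr0 // => r' ne.
rewrite !mxE; case: (boolP (D r' == t)) => //= Dr'; last by rewrite mul0r.
case: eqP => [E|]; last by rewrite mul0r.
case/eqP: ne; rewrite /r -E nth_index // mem_enum; exact: Dr'.
Qed.

Lemma tr_select_mul m t : m = #|[pred r | D r == t]| ->
  (select D m t)^T *m select D m t = diag_mx (\row_r (D r == t)%:R).
Proof.
move=> Em; apply/matrixP => r r'; rewrite !mxE.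
under eq_bigr do rewrite !mxE.
case: (boolP (D r == t)) => [Dr|_]; last first.
  by rewrite /= mul0rn big1 // => s _; rewrite mul0r.
case: (boolP (D r' == t)) => [Dr'|nDr']; last first.
  rewrite big1 => [|s _]; last by rewrite /= mulr0.
  by case: eqP => // E; rewrite -E Dr in nDr'.
have im : (index r (enum [pred r | D r == t]) < m)%N.
  by rewrite Em cardE index_mem mem_enum.
rewrite (bigD1 (Ordinal im)) //= eqxx mul1r big1 ?addr0 => [|s ne]; last first.
  by case: eqP => [E|]; rewrite ?mul0r //; case/eqP: ne; apply: val_inj.
have [->|ne] := eqVneq r r'; first by rewrite eqxx.
case: eqP => // E; case/eqP: ne; apply/esym.
rewrite -(nth_index r (_ : r' \in enum [pred r | D r == t])) ?mem_enum // E.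
by rewrite nth_index // mem_enum.
Qed.

Lemma select_rowwise m p t (Z : T -> 'M[K]_(n, p)) :
  select D m t *m rowwise D Z = select D m t *m Z t.
Proof.
apply/matrixP => s c; rewrite !mxE; apply: eq_bigr => r _; rewrite !mxE.
by case: (D r =P t) => [->|] //=; rewrite !mul0r.
Qed.

Lemma rowwise_mul p q (Z : T -> 'M[K]_(n, p)) (X : 'M[K]_(p, q)) :
  rowwise D Z *m X = rowwise D (fun t => Z t *m X).
Proof. by apply/matrixP => r c; rewrite !mxE; apply: eq_bigr => j _; rewrite mxE. Qed.

Lemma eq_rowwise p (Z Z' : T -> 'M[K]_(n, p)) : Z =1 Z' -> rowwise D Z = rowwise D Z'.
Proof. by move=> E; apply/matrixP => r c; rewrite !mxE E. Qed.

Lemma mul_select_neq0 q m t (X : 'M[K]_(q, m)) s r :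
  (X *m select D m t) s r != 0 -> D r = t.
Proof.
rewrite mxE => nz; apply/eqP; apply: contraNT nz => ne; apply/eqP/big1 => j _.
by rewrite mxE (negPf ne) mulr0.
Qed.

End Selection.

Lemma select_mul_proj (K : fieldType) (T : eqType) n (D : 'I_n -> T)
    n' (D' : 'I_n' -> T) m m' t t' (X : 'M[K]_(n, n')) :
  m' = #|[pred r | D' r == t']| ->
  (forall r c, D r = t -> X r c != 0 -> D' c = t') ->
  select K D m t *m X *m (select K D' m' t')^T *m select K D' m' t' =
  select K D m t *m X.
Proof.
move=> Em' HX; rewrite -mulmxA tr_select_mul //; apply/matrixP => s c.
rewrite mul_mx_diag !mxE.
case: (D' c =P t') => [_|ne]; first by rewrite mulr1.
rewrite mulr0 big1 // => r _; rewrite mxE.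
case: (D r =P t) => [Dr|_]; last by rewrite mul0r.
by have [->|/(HX _ _ Dr)] := eqVneq (X r c) 0; rewrite ?mulr0.
Qed.

Section UniversalCover.
Variables (V A : finType) (Q : quiver V A) (al : V -> nat).
Local Notation W := (freegroup A).
Local Notation cover := (universal_cover Q).
Variable be : (V * W)%type -> nat.
Implicit Types (D : forall i, 'I_(al i) -> W).

(** Such a [D] exists precisely when [be] is compatible with [al]; it fixes the
    basis used for pushing down representations of dimension vector [be]. *)
Definition degree_list D := forall i w, be (i, w) = #|[pred r | D i r == w]|.

Section Functors.
Variable K : fieldType.
Local Notation sel D i w := (select K (D i) (be (i, w)) w).

Definition pushdown D (N : rep cover K be) : rep Q K al := fun a =>
  rowwise (D (src Q a)) (fun w => (sel D (src Q a) w)^T *m N (a, w) *m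
    sel D (tgt Q a) (w * fggen a)%g).

Definition pushdown_hom D D' (f : forall x, 'M[K]_(be x)) i : 'M[K]_(al i) :=
  rowwise (D i) (fun w => (sel D (i) w)^T *m f (i, w) *m sel D' (i) w).

Definition lift_rep D (M : rep Q K al) : rep cover K be := fun aw =>
  sel D (src Q aw.1) aw.2 *m M aw.1 *m (sel D (tgt Q aw.1) (aw.2 * fggen aw.1)%g)^T.

Definition lift_hom D D' (f : forall i, 'M[K]_(al i)) x : 'M[K]_(be x) :=
  select K (D x.1) (be x) x.2 *m f x.1 *m (select K (D' x.1) (be x) x.2)^T.

Lemma pushdown_graded D N : graded (@fggen A) (pushdown D N) D.
Proof. by move=> a r c; rewrite mxE => /mul_select_neq0 ->. Qed.

Lemma select_pushdown D : degree_list D -> forall N a w,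
  sel D (src Q a) w *m pushdown D N a = N (a, w) *m sel D (tgt Q a) (w * fggen a)%g.
Proof.
by move=> hD N a w; rewrite select_rowwise !mulmxA select_trK ?mul1mx.
Qed.

Lemma select_pushdown_hom D D' : degree_list D -> forall f i w,
  sel D (i) w *m pushdown_hom D D' f i = f (i, w) *m sel D' (i) w.
Proof. by move=> hD f i w; rewrite select_rowwise !mulmxA select_trK ?mul1mx. Qed.

Lemma pushdown_is_hom D D' N N' f : degree_list D -> degree_list D' ->
  is_rep_hom N N' f ->
  is_rep_hom (pushdown D N) (pushdown D' N') (pushdown_hom D D' f).
Proof.
move=> hD hD' hf a; rewrite !rowwise_mul; apply: eq_rowwise => w.
rewrite -!mulmxA (select_pushdown_hom D' hD) (select_pushdown hD').
by congr (_ *m _); rewrite !mulmxA; congr (_ *m _); apply: (hf (a, w)).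
Qed.

Lemma pushdown_hom_comp D D' D'' f f' i : degree_list D' ->
  pushdown_hom D D' f i *m pushdown_hom D' D'' f' i =
  pushdown_hom D D'' (fun x => f x *m f' x) i.
Proof.
move=> hD'; rewrite rowwise_mul; apply: eq_rowwise => w.
by rewrite -!mulmxA (select_pushdown_hom D'' hD') !mulmxA.
Qed.

Lemma pushdown_hom1 D i : degree_list D -> pushdown_hom D D (fun x => 1%:M) i = 1%:M.
Proof.
move=> hD; apply/matrixP => r c; rewrite mxE mulmx1 tr_select_mul //.
by rewrite !mxE eqxx.
Qed.

Lemma pushdown_iso D D' N N' : degree_list D -> degree_list D' ->
  rep_iso N N' -> rep_iso (pushdown D N) (pushdown D' N').
Proof.
move=> hD hD' [f [f' [hf hf' ff' f'f]]].
exists (pushdown_hom D D' f), (pushdown_hom D' D f'); split; try exact: pushdown_is_hom.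
- move=> i; rewrite pushdown_hom_comp // -[RHS](pushdown_hom1 i hD).
  by rewrite (functional_extensionality_dep ff').
- move=> i; rewrite pushdown_hom_comp // -[RHS](pushdown_hom1 i hD').
  by rewrite (functional_extensionality_dep f'f).
Qed.

Lemma pushdownK D N : degree_list D -> lift_rep D (pushdown D N) = N.
Proof.
move=> hD; apply: functional_extensionality_dep => -[a w]; rewrite /lift_rep /=.
by rewrite (select_pushdown hD) -mulmxA select_trK ?mulmx1; last exact: hD.
Qed.

Lemma pushdown_homK D D' f x : degree_list D -> degree_list D' ->
  lift_hom D D' (pushdown_hom D D' f) x = f x.
Proof.
move=> hD hD'; case: x => i w; rewrite /lift_hom /=.
by rewrite (select_pushdown_hom D' hD) -mulmxA select_trK ?mulmx1.
Qed.

Lemma lift_repK D M : degree_list D -> graded (@fggen A) M D ->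
  pushdown D (lift_rep D M) = M.
Proof.
move=> hD MD; apply: functional_extensionality_dep => a; apply/matrixP => r c.
rewrite mxE /lift_rep /= -!mulmxA (tr_select_mul _ (hD _ _)) !mulmxA.
rewrite (tr_select_mul _ (hD _ _)) mul_mx_diag mul_diag_mx !mxE eqxx mul1r.
by have [->|/MD ->] := eqVneq (M a r c) 0; rewrite ?mul0r // eqxx mulr1.
Qed.

Lemma lift_homK D D' f i : degree_list D -> degree_list D' -> shifts 1%g D D' f ->
  pushdown_hom D D' (lift_hom D D' f) i = f i.
Proof.
move=> hD hD' sf; apply/matrixP => r c.
rewrite mxE /lift_hom /= -!mulmxA (tr_select_mul _ (hD' _ _)) !mulmxA.
rewrite (tr_select_mul _ (hD _ _)) mul_mx_diag mul_diag_mx !mxE eqxx mul1r.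
by have [->|/sf ->] := eqVneq (f i r c) 0; rewrite ?mul0r // mul1g eqxx mulr1.
Qed.

Lemma lift_is_hom D D' M M' f : degree_list D -> degree_list D' ->
  graded (@fggen A) M D -> graded (@fggen A) M' D' -> shifts 1%g D D' f ->
  is_rep_hom M M' f -> is_rep_hom (lift_rep D M) (lift_rep D' M') (lift_hom D D' f).
Proof.
move=> hD hD' MD MD' sf hf [a w]; rewrite /lift_rep /lift_hom /= !mulmxA.
rewrite select_mul_proj //; last by move=> r c <- /MD.
rewrite [in RHS]select_mul_proj //; last by move=> r c <- /sf ->; rewrite mul1g.
by rewrite -[_ *m M a *m _]mulmxA hf !mulmxA.
Qed.

Lemma lift_hom_comp D D' D'' f f' x : degree_list D' -> shifts 1%g D D' f ->
  lift_hom D D' f x *m lift_hom D' D'' f' x = lift_hom D D'' (fun i => f i *m f' i) x.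
Proof.
move=> hD' sf; case: x => i w; rewrite /lift_hom !mulmxA select_mul_proj ?mulmxA //.
by move=> r c <- /sf ->; rewrite mul1g.
Qed.

Lemma lift_hom1 D x : degree_list D -> lift_hom D D (fun i => 1%:M) x = 1%:M.
Proof. by move=> hD; case: x => i w; rewrite /lift_hom mulmx1 select_trK. Qed.

Lemma lift_iso D D' M M' f f' : degree_list D -> degree_list D' ->
  graded (@fggen A) M D -> graded (@fggen A) M' D' ->
  is_rep_hom M M' f -> shifts 1%g D D' f -> shifts 1%g D' D f' ->
  (forall i, f i *m f' i = 1%:M) -> (forall i, f' i *m f i = 1%:M) ->
  rep_iso (lift_rep D M) (lift_rep D' M').
Proof.
move=> hD hD' MD MD' hf sf sf' ff' f'f; have hf' := rep_hom_inv hf ff' f'f.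
exists (lift_hom D D' f), (lift_hom D' D f'); split; try exact: lift_is_hom.
- move=> x; rewrite lift_hom_comp // -[RHS](lift_hom1 x hD).
  by rewrite (functional_extensionality_dep ff').
- move=> x; rewrite lift_hom_comp // -[RHS](lift_hom1 x hD').
  by rewrite (functional_extensionality_dep f'f).
Qed.

End Functors.

Lemma pushdown_extend (k : fieldType) (K : fieldExtType k) D (N : rep cover k be) :
  extend_scalars K (pushdown D N) = pushdown D (extend_scalars K N).
Proof.
apply: functional_extensionality_dep => a; apply/matrixP => r c.
rewrite !mxE rmorph_sum; apply: eq_bigr => j _; rewrite rmorphM !mxE rmorph_nat.
congr (_ * _); rewrite rmorph_sum; apply: eq_bigr => t _.
by rewrite rmorphM !mxE rmorph_nat.
Qed.

Lemma degree_list_zero D : degree_list D ->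
  (forall i, al i = 0%N) <-> (forall x, be x = 0%N).
Proof.
move=> hD; split=> [z [i w]|z i].
  by rewrite hD; apply: eq_card0 => r; have := ltn_ord r; rewrite {2}z.
apply/eqP; rewrite -leqn0 leqNgt; apply/negP => i0.
have := hD i (D i (Ordinal i0)); rewrite z => /esym/card0_eq/(_ (Ordinal i0)).
by rewrite !inE eqxx.
Qed.

Lemma unshiftable_freegroup D : unshiftable D \/ forall i, al i = 0%N.
Proof.
have [z|nz] := pselect (forall i, al i = 0%N); [by right | left].
have [i0 d0] := exists_dim_gt0 nz.
apply: (unshiftable_torsion d0) => h n /andP[n0 _]; exact: freegroup_torsion_free.
Qed.

(** Endomorphisms over the covering are the endomorphisms of degree [1] of the
    pushdown, and by the graded criterion these see all idempotents. *)
Lemma pushdown_absolutely_indecomposable (F : finFieldType) D (N : rep cover F be) :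
  degree_list D ->
  absolutely_indecomposable (pushdown D N) <-> absolutely_indecomposable N.
Proof.
move=> hD; split=> [/absolutely_indecomposableP [nz triv] K|aiN].
  apply/indecomposableP; split; first by move/(degree_list_zero hD).
  move=> e _ he ee; have := pushdown_is_hom hD hD he; rewrite -pushdown_extend => hpe.
  have [|z|u] := triv K _ I hpe.
  - by move=> i; rewrite pushdown_hom_comp // (functional_extensionality_dep ee).
  - left=> x; rewrite -(pushdown_homK e x hD hD).
    by rewrite (functional_extensionality_dep z) /lift_hom mulmx0 mul0mx.
  - right=> x; rewrite -(pushdown_homK e x hD hD).
    by rewrite (functional_extensionality_dep u) lift_hom1.
have nz : ~ (forall i, al i = 0%N).
  by move=> /(degree_list_zero hD); case: (aiN (F^o : fieldExtType F)).
have noD : unshiftable D by case: (unshiftable_freegroup D).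
apply: (graded_absolutely_indecomposable (@pushdown_graded F D N) noD nz) => K e se he ee.
have /indecomposableP [_ triv] := aiN K.
rewrite pushdown_extend in he.
have gK := @pushdown_graded K D (extend_scalars K N).
have := lift_is_hom hD hD gK gK se he; rewrite pushdownK // => hle.
have [|z|u] := triv _ I hle.
- by move=> x; rewrite lift_hom_comp // (functional_extensionality_dep ee).
- left=> i; rewrite -(lift_homK i hD hD se) (functional_extensionality_dep z).
  by apply/matrixP => r c; rewrite [LHS]mxE mulmx0 mul0mx !mxE.
- right=> i; rewrite -(lift_homK i hD hD se) (functional_extensionality_dep u).
  exact: pushdown_hom1.
Qed.

End UniversalCover.

(** * Dimension vectors of the universal covering *)

Section DimensionVectors.
Variables (V A : finType) (Q : quiver V A) (al : V -> nat).
Local Notation W := (freegroup A).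
Implicit Types (be ga : dimvec (V * W)%type).

Lemma seq_card_fibers (T : eqType) n (s : seq T) : size s = n ->
  exists D : 'I_n -> T, forall t, #|[pred r | D r == t]| = count_mem t s.
Proof.
move=> <-; exists (fun r => tnth (in_tuple s) r) => t.
have : count_mem t (in_tuple s) = count_mem t s by [].
rewrite -{1}(map_tnth_enum (in_tuple s)) count_map => <-.
by rewrite cardE -size_filter; congr size; rewrite enumT.
Qed.

Lemma compatible_degree_list be : compatible al be ->
  exists D : (forall i, 'I_(al i) -> W), degree_list be D.
Proof.
move=> hbe.
have H i : exists Di : 'I_(al i) -> W, forall w, be (i, w) = #|[pred r | Di r == w]|.
  pose s := [seq x <- finsupp be | x.1 == i].
  pose t := flatten [seq nseq (be x) x.2 | x <- s].
  have st : size t = al i.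
    rewrite size_flatten /shape -map_comp sumnE big_map big_filter -hbe.
    by apply: eq_bigr => x _ /=; rewrite size_nseq.
  have [Di Hi] := seq_card_fibers st; exists Di => w; rewrite Hi.
  rewrite count_flatten -map_comp sumnE big_map big_filter.
  under eq_bigr do rewrite /= count_nseq /=.
  rewrite big_mkcond /=; have [win|wout] := boolP ((i, w) \in finsupp be).
    rewrite (bigD1_seq (i, w)) ?fset_uniq //= !eqxx mul1n big1 ?addn0 //.
    move=> [j v] /=; rewrite xpair_eqE; case: eqP => //= _ /negPf ->.
    by rewrite mul0n.
  rewrite fsfun_dflt // big_seq big1 // => -[j v] /= jv.
  case: (j =P i) => // E; case: eqP => [Ev|]; last by rewrite mul0n.
  by move: wout; rewrite -E -Ev jv.
by exists (fun i => sval (cid (H i))) => i; apply: (svalP (cid (H i))).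
Qed.

Lemma degree_list_compatible be (D : forall i, 'I_(al i) -> W) : degree_list be D -> compatible al be.
Proof.
move=> hD i.
have -> : (\sum_(x <- finsupp be | x.1 == i) be x =
  \sum_(x <- finsupp be | x.1 == i) \sum_(r < al i) (D i r == x.2))%N.
  apply: eq_bigr => -[j w] /= /eqP ->; rewrite hD -sum1_card big_mkcond.
  by apply: eq_bigr => r _ /=; rewrite inE; case: (_ == _).
rewrite exchange_big -[RHS]card_ord -sum1_card; apply: eq_bigr => r _.
have rin : (i, D i r) \in finsupp be.
  rewrite mem_finsupp hD -lt0n; apply/card_gt0P; exists r; rewrite inE; exact: eqxx.
rewrite big_mkcond (bigD1_seq (i, D i r)) ?fset_uniq //= !eqxx big1 ?addn0 //.
move=> [j w] /= ne; case: (j =P i) => // E; case: eqP => // Ew.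
by rewrite E Ew eqxx in ne.
Qed.

Lemma degree_dimvec (D : forall i, 'I_(al i) -> W) : exists be : dimvec (V * W)%type, degree_list be D.
Proof.
pose s := [seq (tag b, D (tag b) (tagged b)) | b : {i : V & 'I_(al i)}].
exists [fsfun x in [fset x in s]%fset => #|[pred r | D x.1 r == x.2]|] => i w.
rewrite fsfunE /=; case: ifPn => // nin.
apply/esym/eq_card0 => r; rewrite inE; apply/negP => /= /eqP E.
case/negP: nin; rewrite in_fset -E; apply/mapP.
by exists (Tagged (fun i => 'I_(al i)) r); rewrite ?mem_enum.
Qed.

Lemma equivalent_refl be : equivalent be be.
Proof. by exists 1%g => -[i w]; rewrite /cover_act /= mul1g. Qed.

Variable S : set (dimvec (V * W)%type).
Hypothesis hS : complete_representatives al S.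

Lemma equivalent_eq be ga : S be -> S ga -> equivalent be ga -> be = ga.
Proof.
move=> Sbe Sga bega; have [+ H] := hS => /(_ be Sbe)/H [ga' [_ u]].
have <- := u be (conj Sbe (equivalent_refl be)).
by apply: u.
Qed.

Lemma representatives_degree_list be : S be -> exists D : (forall i, 'I_(al i) -> W), degree_list be D.
Proof. by move=> Sbe; apply: compatible_degree_list; apply: hS.1. Qed.

(** The coefficient graph of the pushdown is connected, so up to translation all
    degrees are words no longer than the total dimension. The relation [rho]
    compares a dimension vector with such a choice of words, uniformly in the
    field. *)
Lemma finite_nonempty_representatives :
  finite_set [set be | S be /\ exists (F : finFieldType)
    (N : rep (universal_cover Q) F be), absolutely_indecomposable N].
Proof.
set S1 := (X in finite_set X).
pose basis := {i : V & 'I_(al i)}.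
pose Theta := {ffun basis -> #|{: basis}|.-bseq (A * bool)}.
pose rho be (th : Theta) := exists c : W, forall i w,
  be (i, c * w)%g = #|[pred r : 'I_(al i) |
     th (Tagged (fun i => 'I_(al i)) r) == fgword w :> seq _]|.
have rho_inj be ga th : S be -> S ga -> rho be th -> rho ga th -> be = ga.
  move=> Sbe Sga [c Hc] [c' Hc']; apply: equivalent_eq => //.
  exists (c' * c^-1)%g => -[i w]; rewrite /cover_act /= -mulgA Hc' -Hc.
  by rewrite mulgA mulgV mul1g.
have rho_total be : S1 be -> exists th, rho be th.
  move=> [Sbe [F [N aiN]]]; have [D hD] := representatives_degree_list Sbe.
  have aiP := (pushdown_absolutely_indecomposable N hD).2 aiN.
  have /indecomposableP [nz triv] := absolutely_indecomposableW aiP.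
  have [i0 d0] := exists_dim_gt0 nz.
  pose b0 : basis := Tagged (fun i => 'I_(al i)) (Ordinal d0).
  pose c := D i0 (Ordinal d0).
  have H (b : basis) : exists u : freegroup A, (size u <= #|{: basis}|)%N /\
      D (tag b) (tagged b) = (c * u)%g.
    by have [u su E] := graded_bounded b0 triv (@pushdown_graded _ _ _ _ _ F D N) b; exists u.
  pose u b := sval (cid (H b)).
  have su b : (size (u b) <= #|{: basis}|)%N := (svalP (cid (H b))).1.
  have Eu b : D (tag b) (tagged b) = (c * u b)%g := (svalP (cid (H b))).2.
  exists [ffun b => Bseq (su b)], c => i w; rewrite hD; apply: eq_card => r.
  rewrite !inE ffunE /=; rewrite -[D i r]/(D (tag (Tagged (fun i => 'I_(al i)) r))
    (tagged (Tagged (fun i => 'I_(al i)) r))) Eu (inj_eq (mulgI c)).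
  by rewrite -val_eqE.
pose h th := if pselect (exists be, S1 be /\ rho be th) is left e
  then sval (cid e) else [fsfun].
apply: (@sub_finite_set _ _ (h @` [set: Theta])%classic); last first.
  exact/finite_image/finite_finset.
move=> be S1be; have [th Hth] := rho_total be S1be; exists th => //.
rewrite /h; case: pselect => [e|[]]; last by exists be.
have [S1ga Hga] := svalP (cid e).
by apply: rho_inj Hga Hth; [case: S1ga | case: S1be].
Qed.

End DimensionVectors.

(** * Counting over a finite field *)

Section Count.
Variables (V A : finType) (Q : quiver V A) (al : V -> nat).
Local Notation W := (freegroup A).
Local Notation cover := (universal_cover Q).
Variable S : set (dimvec (V * W)%type).
Hypothesis hS : complete_representatives al S.

(** The field varies here, so that one finite set serves for all fields. *)
Definition nonempty_representatives := [set be | S be /\ exists (F : finFieldType)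
  (N : rep cover F be), absolutely_indecomposable N]%classic.

Variables (F : finFieldType) (n : nat) (R : 'I_n -> rep Q F al).
Hypothesis sysR : class_system R.
Variable c : dimvec (V * W)%type -> nat.
Hypothesis hc : forall be : dimvec (V * W)%type,
  (@absindec_classes _ _ cover F be #= `I_(c be))%card.

(** Pushing down identifies the isomorphism classes over the covering, up to
    translation, with the classes graded by the free group. *)
Lemma card_gradable_classes :
  #|gradable_classes R (@fggen A)| =
  (\sum_(be <- fset_set nonempty_representatives) c be)%N.
Proof.
have [aiR surjR uniqR] := sysR.
set s := fset_set _.
have sE be : (be \in s) = `[< nonempty_representatives be >].
  rewrite in_fset_set; last exact: (finite_nonempty_representatives Q hS).
  by apply/idP/asboolP; rewrite inE.
have sysH (k : s) := class_systemP (hc (val k)).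
pose Rk (k : s) := sval (cid (sysH k)).
have sysk (k : s) : class_system (Rk k) := svalP (cid (sysH k)).
have Sk (k : s) : S (val k) by have := valP k; rewrite sE => /asboolP [].
pose Dk (k : s) := sval (cid (representatives_degree_list hS (Sk k))).
have hDk (k : s) : degree_list (val k) (Dk k) := svalP (cid (representatives_degree_list hS (Sk k))).
pose T := {k : s & 'I_(c (val k))}.
have aiP (x : T) : absolutely_indecomposable (pushdown (Dk (tag x)) (Rk _ (tagged x))).
  by apply/(pushdown_absolutely_indecomposable _ (hDk _)); case: (sysk (tag x)).
pose idx (x : T) := sval (cid (surjR _ (aiP x))).
have idxP x : rep_iso (R (idx x)) (pushdown (Dk (tag x)) (Rk _ (tagged x))) :=
  svalP (cid (surjR _ (aiP x))).
have card_T : #|{: T}| = (\sum_(be <- s) c be)%N.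
  rewrite card_tagged sumnE big_map big_enum /= big_seq_fsetE /=.
  by apply: eq_bigr => k _; rewrite card_ord.
rewrite -card_T; suff [inj_idx img] : injective idx /\
    forall j, gradable (@fggen A) (R j) <-> exists x, j = idx x.
  rewrite -(card_imset _ inj_idx); apply: eq_card => j; rewrite inE.
  apply/asboolP/imsetP => [/img [x ->]|[x _ ->]]; first by exists x.
  by apply/img; exists x.
split=> [[k j] [k' j'] E|j].
  have iP := rep_iso_trans (rep_iso_sym (idxP (Tagged _ j)))
    (eq_rect_r (fun i => rep_iso (R i) _) (idxP (Tagged _ j')) E).
  have indP := absolutely_indecomposableW (aiP (Tagged _ j)).
  have := graded_iso (@finField_idempotent_powers F)
    (@pushdown_graded _ _ _ _ _ F (Dk k) (Rk k j))
    (@pushdown_graded _ _ _ _ _ F (Dk k') (Rk k' j')) indP iP.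
  move=> {iP E} iso_shift; have Ek : k = k'.
    have [h [f [f' [hf sf _ ff' _]]]] := iso_shift.
    have [i|p hp] := shifts_perm sf.
      by have [+ _] := mulmx1_unit (ff' i); rewrite unitmxE unitfE.
    apply: val_inj; apply: (equivalent_eq hS (Sk k) (Sk k')).
    exists h => -[i w]; rewrite /cover_act /= (hDk k') (hDk k).
    rewrite -(fintype.card_image (@perm_inj _ (p i)) [pred r | Dk k i r == w]).
    apply: eq_card => r; rewrite inE; apply/eqP/fintype.imageP => /= [Er|[r' + ->]].
      exists ((p i)^-1%g r); rewrite ?permKV // inE; apply/eqP.
      by apply: (mulgI h); rewrite -hp permKV.
    by rewrite inE hp => /eqP ->.
  case: k' / Ek j' iso_shift => j' [h [f [f' [hf sf sf' ff' f'f]]]].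
  have [i|p hp] := shifts_perm sf.
    by have [+ _] := mulmx1_unit (ff' i); rewrite unitmxE unitfE.
  have [nz _] := indP; have [noD|//] := unshiftable_freegroup (Dk k).
  have h1 : h = 1%g := noD h (fun i => p i) hp.
  rewrite h1 invg1 in sf sf'.
  have := lift_iso (hDk k) (hDk k) (@pushdown_graded _ _ _ _ _ F (Dk k) (Rk k j))
    (@pushdown_graded _ _ _ _ _ F (Dk k) (Rk k j')) hf sf sf' ff' f'f.
  rewrite !pushdownK //; by case: (sysk k) => _ _ H /H ->.
split=> [[N [D [iN ND]]]|[x ->]]; last first.
  by exists (pushdown (Dk (tag x)) (Rk _ (tagged x))), (Dk (tag x)); split;
    [apply: idxP | apply: pushdown_graded].
have [be hbe] := degree_dimvec D.
have [ga [[Sga [u hu]] _]] := hS.2 be (degree_list_compatible hbe).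
pose D' i r := (u * D i r)%g.
have hD' : degree_list ga D'.
  move=> i w; rewrite (_ : (i, w) = cover_act u (i, (u^-1 * w)%g)); last first.
    by rewrite /cover_act /= mulVKg.
  rewrite hu hbe; apply: eq_card => r; rewrite !inE /D'.
  by rewrite -(inj_eq (mulgI u)) mulVKg.
have ND' : graded (@fggen A) N D' by move=> a r r' /ND E; rewrite /D' E mulgA.
have aiN : absolutely_indecomposable N := absolutely_indecomposable_iso iN (aiR j).
have ail : absolutely_indecomposable (lift_rep ga D' N).
  by apply/(pushdown_absolutely_indecomposable _ hD'); rewrite lift_repK.
have gas : ga \in s by rewrite sE; apply/asboolP; split=> //; exists F, (lift_rep ga D' N).
pose k : s := [` gas]%fset.
have [_ surjk _] := sysk k; have [j0 ij0] := surjk _ ail.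
exists (Tagged (fun k : s => 'I_(c (val k))) j0 : T); apply: uniqR.
apply: rep_iso_trans iN _; apply: rep_iso_sym; apply: rep_iso_trans (idxP _) _ => /=.
apply: rep_iso_trans (pushdown_iso (hDk k) hD' ij0) _.
by rewrite lift_repK //; apply: rep_iso_refl.
Qed.

End Count.

(** Gradings by the free group are compared with those by an [l]-group that
    detects the words of length at most twice the total dimension plus one. *)
Lemma gradable_classes_mod (V A : finType) (Q : quiver V A) (al : V -> nat) l
    (F : finFieldType) n (R : 'I_n -> rep Q F al) :
  prime l -> (l %| #|F|.-1)%N -> (forall i, (al i < l)%N) ->
  ((#|{: {i : V & 'I_(al i)}}| + #|{: {i : V & 'I_(al i)}}|).+1 < l)%N ->
  class_system R -> #|gradable_classes R (@fggen A)| = n %[mod l].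
Proof.
move=> pr_l lF all_l Ll sysR; have [aiR _ _] := sysR.
case: n R sysR aiR => [|n] R sysR aiR; first by rewrite eq_card0 // => -[].
have [nz _] := absolutely_indecomposableW (aiR ord0).
have [i0 d0] := exists_dim_gt0 nz.
have [zeta zp] := root_of_order pr_l lF.
have [gT [g [lG inj]]] := free_group_residually_lgroup A pr_l Ll.
rewrite -(lgroup_gradable_classes pr_l zp all_l d0 sysR g lG).
congr (_ %% l)%N; apply: eq_card => j; rewrite !inE.
by apply/asboolP/asboolP => /(gradable_lift (R j) inj).
Qed.

Lemma horner_dvd_sub1 (p : {poly int}) (q : int) : (q - 1 %| p.[q] - p.[1])%Z.
Proof.
have /factor_theorem [r Er] : root (p - p.[1]%:P) 1.
  by rewrite rootE hornerD hornerN hornerC subrr.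
have := congr1 (horner^~ q) Er.
rewrite /= hornerD hornerN hornerC hornerM hornerXsubC => ->.
by apply/dvdzP; exists r.[q].
Qed.

(** * The value at one *)

Lemma empty_kac_polynomial (V A : Type) (Q : quiver V A) (d : V -> nat) (P : {poly int}) :
  is_kac_polynomial Q d P ->
  ~ (exists (F : finFieldType) (N : rep Q F d), absolutely_indecomposable N) -> P = 0.
Proof.
move=> hP none; apply: is_kac_polynomial_unique hP _ => F.
exists 0%N; last by rewrite horner0.
rewrite II0 card_eq0; apply/eqP/seteqP; split=> // C [N aiN _].
by apply: none; exists F, N.
Qed.

Local Open Scope classical_set_scope.

Theorem corollary1p2 (V A : finType) (Q : quiver V A) (alpha : V -> nat)
    (a : {poly int}) (ha : is_kac_polynomial Q alpha a)
    (acov : dimvec (V * freegroup A)%type -> {poly int})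
    (hacov : forall beta : dimvec (V * freegroup A)%type,
        is_kac_polynomial (universal_cover Q) beta (acov beta))
    (S : set (dimvec (V * freegroup A)%type))
    (hS : complete_representatives alpha S) :
  finite_set [set beta | S beta /\ (acov beta).[1] <> 0] /\
  a.[1] = \sum_(beta \in S) (acov beta).[1].
Proof.
set S1 := nonempty_representatives Q S.
have finS1 : finite_set S1 := finite_nonempty_representatives Q hS.
have acov0 beta : S beta -> ~ S1 beta -> acov beta = 0.
  move=> Sbeta nS1; apply: (empty_kac_polynomial (hacov beta)) => ex.
  by apply: nS1; split.
have subS1 : [set beta | S beta /\ (acov beta).[1] <> 0] `<=` S1.
  move=> beta [Sbeta nz]; apply: contrapT => /(acov0 _ Sbeta) E.
  by apply: nz; rewrite E horner0.
split; first exact: sub_finite_set subS1 finS1.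
have -> : \sum_(beta \in S) (acov beta).[1] = \sum_(beta \in S1) (acov beta).[1].
  apply/esym/fsbig_widen => [beta [] //|beta [/= Sbeta nS1]].
  by rewrite /= (acov0 _ Sbeta nS1) horner0.
rewrite fsbig_finite //=.
(* The polynomials [a] and [b] agree at [1] modulo infinitely many primes. *)
pose b : {poly int} := \sum_(beta <- fset_set S1) acov beta.
have bE x : b.[x] = \sum_(beta <- fset_set S1) (acov beta).[x] by rewrite /b horner_sum.
rewrite -bE; apply/eqP; rewrite -subr_eq0 -hornerN -hornerD; set p := a - b.
pose B := #|{: {i : V & 'I_(alpha i)}}|.
have [l ll pr_l] := prime_above (maxn 2 (maxn (\sum_i alpha i)
  (maxn (B + B).+1 `|p.[1]|%N))).
move: ll; rewrite !gtn_max => /and4P[l2 la lB lp].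
have l1 : (0 < l.-1)%N by case: (l) l2 => // -[].
(* By Fermat's little theorem [l] divides [2 ^ (l - 1) - 1]. *)
have [F F2 cF] := pPrimePowerField (isT : prime 2) l1.
have lF : (l %| #|F|.-1)%N.
  rewrite cF -subn1 -eqn_mod_dvd ?expn_gt0 //.
  have cop2 : coprime 2 l by rewrite prime_coprime // dvdn_prime2 // neq_ltn l2.
  by have := Euler_exp_totient cop2; rewrite totient_prime // => /eqP.
have all_l i : (alpha i < l)%N by apply: leq_ltn_trans la; apply: dim_le_sum.
have [n hn an] := ha F; have [R sysR] := class_systemP hn.
pose c (beta : dimvec (V * freegroup A)%type) := s2val (cid2 (hacov beta F)).
have hc (beta : dimvec (V * freegroup A)%type) : (@absindec_classes _ _ (universal_cover Q) F beta #= `I_(c beta))%card :=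
  s2valP (cid2 (hacov beta F)).
have cE (beta : dimvec (V * freegroup A)%type) : (acov beta).[#|F|%:R] = (c beta)%:R := s2valP' (cid2 (hacov beta F)).
have bF : b.[#|F|%:R] = #|gradable_classes R (@fggen A)|%:R.
  by rewrite bE (card_gradable_classes hS sysR hc) natr_sum; apply: eq_bigr.
have pF : (l%:Z %| p.[#|F|%:R])%Z.
  rewrite hornerD hornerN an bF -eqz_mod_dvd !natz !modz_nat.
  by rewrite (gradable_classes_mod pr_l lF all_l lB sysR).
have lF' : (l%:Z %| #|F|%:R - 1)%Z.
  have F0 : (0 < #|F|)%N by rewrite cF expn_gt0.
  by rewrite natz -[#|F|](prednK F0) -addn1 PoszD addrK.
have lp1 : (l%:Z %| p.[1])%Z.
  rewrite -(subKr p.[#|F|%:R] p.[1]) rpredB //.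
  exact: dvdz_trans lF' (horner_dvd_sub1 p _).
have [//|nz] := eqVneq p.[1] 0.
have : (l <= `|p.[1]|)%N by rewrite dvdn_leq ?absz_gt0.
by rewrite leqNgt lp.
Qed.
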